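(* Let $z,c\ge0$. Let $(z_t,c_t)\in\mathbb{R}_{\ge0}^2$ be the sequential test statistic with initial value $(z_0,c_0)=(z,c)$ and update rule $$z_{t+1}=z_t\,\frac{p_1(x_{t+1})}{p_0(x_{t+1})},\qquad c_{t+1}=\max\{c_t,\,m^*(z_t)\}-1,$$ where, for $z\ge0$, $$m^*(z)=\operatorname*{arg\,max}_{m\in\mathbb{N}_{\ge1}}\frac{g(z)-\mathbb{E}_0\bigl[\rho\bigl(z\frac{p_1(X)}{p_0(X)},m-1\bigr)\bigr]}{m},$$ and $\rho:\mathbb{R}_{\ge0}\times\mathbb{N}_{\ge0}\to[0,1]$ solves $$\frac{g(z)-\rho(z,n)}{n}=\sup_{m\in\mathbb{N},\,m\ge n}\frac{g(z)-\mathbb{E}_0\bigl[\rho\bigl(z\frac{p_1(X)}{p_0(X)},m-1\bigr)\bigr]}{m}\quad (z\ge0,\ n\ge1),\qquad \rho(z,0)=g(z).$$ Then the stopping rule $$\psi_t^*=1-\frac{c_t}{\max\{c_t,\,m^*(z_t)\}}$$ is optimal for the nonparametric Kiefer--Weiss problem $$\inf_{\psi\in\mathcal{I}_c^\infty}\ \inf_{\delta}\ \alpha(\psi,\delta)+z\,\beta(\psi,\delta),$$ i.e. $\psi^*=(\psi_0^*,\psi_1^*,\ldots)\in\mathcal{I}_c^\infty$ attains the outer infimum.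
   Context: $(\mathcal{X},\mathcal{F})$ is a measurable space, $\bm{X} = (X_1,X_2,\ldots)$ a random sequence in $\mathcal{X}$, $\bm{x}_t=(x_1,\ldots,x_t)$. Under hypothesis $\mathcal{H}_i$, $i\in\{0,1\}$, $\bm{X}$ is i.i.d. according to $P_i$. Standing assumptions: $P_1$ is absolutely continuous with respect to $P_0$, and $D_{\mathrm{KL}}(P_0\Vert P_1)$ is non-zero and finite; $p_0,p_1$ are the densities of $P_0,P_1$ with respect to a suitable background measure. $\mathbb{E}_0$ is expectation under $\mathcal{H}_0$, $X$ is a generic observation, and $g(z)=\min\{1,z\}$ for $z\ge0$. Writing $x^*=\operatorname{arg\,max}_x f(x)$ means that $x^*$ is a maximizer of $f$ (policies, and hence such selections, are understood to be measurable). A stopping policy is a sequence $\psi=(\psi_0,\psi_1,\ldots)$ of (measurable) functions $\psi_t=\psi_t(\bm{x}_t)\in[0,1]$ ($\psi_0$ a constant), where $\psi_t(\bm{x}_t)$ is the probability of stopping at time $t$ given that the test has not stopped before and $\bm{x}_t$ has been observed. $T$ is the resulting stopping time, with $\mathbb{P}[T=t\mid\bm{X}_t=\bm{x}_t]=\psi_t(\bm{x}_t)\prod_{n=0}^{t-1}(1-\psi_n(\bm{x}_n))$. A decision policy is a sequence $\delta=(\delta_0,\delta_1,\ldots)$ of (measurable) functions $\delta_t(\bm{x}_t)\in[0,1]$; upon stopping at $T=t$ the test outputs $D\in\{0,1\}$ ($D=i$ means acceptance of $\mathcal{H}_i$) with $\delta_t(\bm{x}_t)=\mathbb{E}[D\mid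 T=t,\bm{X}_t=\bm{x}_t]$. With $\mathbb{E}_{i,\psi,\delta}$ the expectation under $\mathcal{H}_i$, $\alpha(\psi,\delta)=\mathbb{E}_{0,\psi,\delta}[D]$ and $\beta(\psi,\delta)=\mathbb{E}_{1,\psi,\delta}[1-D]$. $\mathcal{I}_c^\infty$ is the set of stopping policies $\psi$ with $\mathbb{E}_{\mathbf{P},\psi}[T]\le c$ for every probability measure $\mathbf{P}$ on $\mathcal{X}^\infty$ (as distribution of $\bm{X}$); equivalently, for every $\bm{x}\in\mathcal{X}^\infty$ the conditional expectation of $T$ given $\bm{X}=\bm{x}$ is at most $c$. *)

(* Defs.v *)
From HB Require Import structures.
From mathcomp Require Import all_boot all_order all_algebra.
From mathcomp Require Import all_classical all_reals all_analysis.

Set Implicit Arguments.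
Unset Strict Implicit.
Unset Printing Implicit Defensive.

Import Order.TTheory GRing.Theory Num.Theory.
Import numFieldNormedType.Exports.

Local Open Scope classical_set_scope.
Local Open Scope ring_scope.

Section sequence_space.
Context {d : measure_display} (X : measurableType d).

Definition cylinders : set (set (nat -> X)) :=
  [set C | exists n, exists2 A, measurable A & C = [set x : nat -> X | A (x n)]].

(* X^oo with the product sigma-algebra.  Time is shifted by one: the entry
   [x n] of a sequence is the observation x_{n+1}. *)
Definition seqspace := g_sigma_algebraType cylinders.

(* (x_1, ..., x_t) *)
Definition observed (t : nat) (x : seqspace) : t.-tuple X :=
  [tuple x i | i < t].

End sequence_space.
Arguments observed {d X} t x.

Section testing.
Context {d : measure_display} {X : measurableType d} {R : realType}.

(* Q is the law on X^oo of an i.i.d. sequence with marginal P. *)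
Definition iid_law (P : probability X R) (Q : probability (seqspace X) R) :=
  forall (n : nat) (A : nat -> set X), (forall i, measurable (A i)) ->
    Q [set x | forall i, (i < n)%N -> A i (x i)]
    = (\prod_(i < n) fine (P (A i)))%:E.

Definition is_density (mu : {measure set X -> \bar R}) (P : probability X R)
    (p : X -> R) :=
  [/\ measurable_fun [set: X] p,
      forall x, 0 <= p x &
      forall A, measurable A -> P A = (\int[mu]_(x in A) (p x)%:E)%E].

(* D_KL(P0 || P1), for densities p0, p1 of P0, P1: the quotient p0 / p1 is
   +oo where p1 = 0 < p0, and the points where p0 = 0 are P0-negligible. *)
Definition KL_divergence (P0 : probability X R) (p0 p1 : X -> R) : \bar R :=
  (\int[P0]_x lne ((p0 x)%:E / (p1 x)%:E))%E.

(* Stopping policies and decision policies have the same shape. *)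
Definition policy := forall t : nat, t.-tuple X -> R.

Definition is_policy (psi : policy) :=
  forall t, measurable_fun [set: t.-tuple X] (psi t) /\
            forall x, 0 <= psi t x <= 1.

(* Conditional probability of T = t given the observations. *)
Definition stop_prob (psi : policy) (t : nat) (x : seqspace X) : R :=
  psi t (observed t x) * \prod_(n < t) (1 - psi n (observed n x)).

(* Conditional probability of T = +oo given the observations. *)
Definition never_prob (psi : policy) (x : seqspace X) : \bar R :=
  (1 - \sum_(0 <= t <oo) (stop_prob psi t x)%:E)%E.

(* E_{Q,psi}[T]; recall that +oo * 0 = 0 in \bar R. *)
Definition expected_time (Q : probability (seqspace X) R) (psi : policy)
    : \bar R :=
  (\int[Q]_x (\sum_(0 <= t <oo) (t%:R * stop_prob psi t x)%:E
              + +oo * never_prob psi x))%E.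

(* The class I_c^oo. *)
Definition uniform_budget (c : R) : set policy :=
  [set psi | is_policy psi /\
    forall Q : probability (seqspace X) R, (expected_time Q psi <= c%:E)%E].

(* Error probabilities E_Q[D] and E_Q[1 - D].  D is only defined upon
   stopping; T is almost surely finite when psi is in some I_c^oo. *)
Definition type1_error (Q : probability (seqspace X) R) (psi delta : policy)
    : \bar R :=
  (\int[Q]_x \sum_(0 <= t <oo)
     (stop_prob psi t x * delta t (observed t x))%:E)%E.

Definition type2_error (Q : probability (seqspace X) R) (psi delta : policy)
    : \bar R :=
  (\int[Q]_x \sum_(0 <= t <oo)
     (stop_prob psi t x * (1 - delta t (observed t x)))%:E)%E.

(* The inner infimum, over decision policies. *)
Definition weighted_risk (Q0 Q1 : probability (seqspace X) R) (z : R)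
    (psi : policy) : \bar R :=
  ereal_inf [set (type1_error Q0 psi delta
                  + z%:E * type2_error Q1 psi delta)%E | delta in is_policy].

Definition g (z : R) : R := Num.min 1 z.

(* (g(z) - E_0[rho(z p1(X)/p0(X), m - 1)]) / m, for m >= 1.  Here and below
   p1/p0 is 0 where p0 = 0, by the convention on division by zero. *)
Definition gain (P0 : probability X R) (p0 p1 : X -> R) (rho : R -> nat -> R)
    (z : R) (m : nat) : R :=
  (g z - \int[P0]_x rho (z * (p1 x / p0 x)) m.-1) / m%:R.

(* Only the values of rho at z >= 0 matter. *)
Definition solves_rho (P0 : probability X R) (p0 p1 : X -> R)
    (rho : R -> nat -> R) :=
  [/\ forall n, measurable_fun (`[0, +oo[%classic : set R) (rho ^~ n),
      forall z n, 0 <= z -> 0 <= rho z n <= 1,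
      forall z, 0 <= z -> rho z 0%N = g z &
      forall z n, 0 <= z -> (1 <= n)%N ->
        (g z - rho z n) / n%:R
        = sup [set gain P0 p0 p1 rho z m | m in [set m | (n <= m)%N]]].

(* A measurable selection z |-> m^*(z) of maximizers over m >= 1. *)
Definition argmax_gain (P0 : probability X R) (p0 p1 : X -> R)
    (rho : R -> nat -> R) (mstar : R -> nat) :=
  measurable_fun (`[0, +oo[%classic : set R) mstar /\
  forall z, 0 <= z -> (1 <= mstar z)%N /\
    forall m, (1 <= m)%N ->
      gain P0 p0 p1 rho z m <= gain P0 p0 p1 rho z (mstar z).

Definition update (p0 p1 : X -> R) (mstar : R -> nat) (zc : R * R) (x : X)
    : R * R :=
  (zc.1 * (p1 x / p0 x), Num.max zc.2 (mstar zc.1)%:R - 1).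

(* (z_t, c_t) as a function of x_1, ..., x_t. *)
Definition statistic (p0 p1 : X -> R) (mstar : R -> nat) (z c : R)
    (t : nat) (x : t.-tuple X) : R * R :=
  foldl (update p0 p1 mstar) (z, c) x.

Definition psi_star (p0 p1 : X -> R) (mstar : R -> nat) (z c : R) : policy :=
  fun t x => let: (zt, ct) := statistic p0 p1 mstar z c x in
    1 - ct / Num.max ct (mstar zt)%:R.

End testing.
Arguments policy {d} X R.

(* Main.v *)
(* Since P1 << P0, the likelihood ratio turns both errors into expectations
   under P0, and the best decision makes the risk of a stopping policy equal to
   E0 [sum_t P(T = t | x) g(z_t)].  Testing the budget constraint against Dirac
   laws of the whole sequence shows that it holds pathwise, so a policy carries
   a remaining budget c_t along each sequence.  Interpolate rho(z, .) linearly
   between integers.  Then S_t rho(z_t, c_t), with S_t the probability of not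
   stopping before t, is a submartingale up to the stopping cost for every
   policy, and exactly balanced for psi*; as S_t = O(1/t), summing over t gives
   the optimality of psi*.  Equality for psi* rests on the concavity in n of
   g(z) - rho(z, n): beyond m*(z) it makes the averaged saving per unit of
   budget nonincreasing, so that not stopping at all is optimal there. *)
Require Import Defs.
From HB Require Import structures.
From mathcomp Require Import all_boot all_order all_algebra.
From mathcomp Require Import all_classical all_reals all_analysis.
From mathcomp Require Import measurable_realfun ring lra.
Set Implicit Arguments.
Unset Strict Implicit.
Unset Printing Implicit Defensive.
Import Order.TTheory GRing.Theory Num.Theory.
Import numFieldNormedType.Exports.
Local Open Scope classical_set_scope.
Local Open Scope ring_scope.

(** * Linear interpolation of sequences *)

Section interpolation.
Context {R : realType}.
Implicit Types (a b : nat -> R) (x y : R) (n j : nat).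

Definition interp a x : R :=
  ((Num.truncn x).+1%:R - x) * a (Num.truncn x)
  + (x - (Num.truncn x)%:R) * a (Num.truncn x).+1.

Lemma interp_seg a j x : j%:R <= x <= j.+1%:R ->
  interp a x = (j.+1%:R - x) * a j + (x - j%:R) * a j.+1.
Proof.
move=> /andP[jx]; rewrite le_eqVlt => /predU1P[->|xj].
  rewrite /interp natrK. ring.
rewrite /interp; suff -> : Num.truncn x = j by [].
by apply/eqP; rewrite truncn_eq ?jx//; exact: le_trans jx.
Qed.

Lemma interp_nat a n : interp a n%:R = a n.
Proof. by rewrite (@interp_seg a n) ?lexx ?ler_nat ?leqnSn//; ring. Qed.

Lemma truncn_seg x : 0 <= x ->
  (Num.truncn x)%:R <= x <= (Num.truncn x).+1%:R.
Proof. by move=> /truncn_itv /andP[-> /ltW ->]. Qed.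

Lemma interp_subr1 a x : 1 <= x ->
  interp a (x - 1) = interp (fun n => a n.-1) x.
Proof.
move=> x1; have y0 : 0 <= x - 1 by lra.
have /andP[jx xj] := truncn_seg y0; set j := Num.truncn _ in jx xj *.
rewrite (@interp_seg a j) ?jx// (@interp_seg _ j.+1)/=.
  by ring.
by move: jx xj; rewrite -!natr1 => ? ?; apply/andP; split; lra.
Qed.

Lemma le_interp a b x : 0 <= x ->
  (forall n, (Num.truncn x <= n)%N -> a n <= b n) -> interp a x <= interp b x.
Proof.
move=> /truncn_seg/andP[jx xj] ab.
by rewrite /interp lerD// ler_wpM2l ?subr_ge0 ?ab.
Qed.

Lemma interp_cst k x : interp (fun=> k) x = k.
Proof. by rewrite /interp -natr1; ring. Qed.

Lemma interp_ratio a x y : 0 <= a 0%N ->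
  (forall n m, (0 < n <= m)%N -> n%:R * a m <= m%:R * a n) ->
  0 <= x <= y -> x * interp a y <= y * interp a x.
Proof.
move=> a0 aR /andP[x0 xy]; have y0 := le_trans x0 xy.
have aR1 n : n%:R * a n.+1 <= n.+1%:R * a n.
  case: n => [|n]; first by rewrite mul0r mul1r.
  by apply: aR; rewrite /= leqnSn.
have /andP[ix xi] := truncn_seg x0; have /andP[jy yj] := truncn_seg y0.
set i := Num.truncn x in ix xi; set j := Num.truncn y in jy yj.
have ij : (i <= j)%N by apply: le_truncn.
rewrite (@interp_seg a i x) ?ix// (@interp_seg a j y) ?jy//.
move: ij; rewrite leq_eqVlt => /predU1P[<-|ij].
  rewrite -subr_ge0 (_ : _ - _ = (y - x) * (i.+1%:R * a i - i%:R * a i.+1)).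
    by rewrite mulr_ge0// subr_ge0.
  by ring.
set A := (X in x * X <= _); set B := (X in _ <= y * X).
have i1 : 0 < i.+1%:R :> R by rewrite ltr0n.
have j1 : 0 < j%:R :> R by rewrite ltr0n (leq_trans _ ij).
have HB : x * a i.+1 <= i.+1%:R * B.
  rewrite /B -subr_ge0.
  rewrite (_ : _ - _ = (i.+1%:R - x) * (i.+1%:R * a i - i%:R * a i.+1)).
    by rewrite mulr_ge0// subr_ge0.
  by ring.
have HA : j%:R * A <= y * a j.
  rewrite /A -subr_ge0.
  rewrite (_ : _ - _ = (y - j%:R) * (j.+1%:R * a j - j%:R * a j.+1)).
    by rewrite mulr_ge0// subr_ge0.
  by ring.
have Hij : i.+1%:R * a j <= j%:R * a i.+1 by apply: aR.
rewrite -(ler_pM2l (mulr_gt0 i1 j1)).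
apply: (@le_trans _ _ (i.+1%:R * x * (y * a j))).
  by rewrite (_ : _ * (x * A) = i.+1%:R * x * (j%:R * A)); [
    rewrite ler_wpM2l// mulr_ge0// ltW | ring].
apply: (@le_trans _ _ (x * y * (j%:R * a i.+1))).
  by rewrite (_ : i.+1%:R * x * _ = x * y * (i.+1%:R * a j)); [
    rewrite ler_wpM2l// mulr_ge0 | ring].
by rewrite (_ : _ * (y * B) = y * j%:R * (i.+1%:R * B)); [
  rewrite (_ : x * y * _ = y * j%:R * (x * a i.+1)); [
  rewrite ler_wpM2l// mulr_ge0// ltW | ring] | ring].
Qed.

End interpolation.

(** * The optimality equation *)

Lemma g_itv {R : realType} (z : R) : 0 <= z -> 0 <= g z <= 1.
Proof. by move=> z0; rewrite /g le_min z0 ler01 ge_min lexx. Qed.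

Lemma measurable_fun_ge0V {d} {T : measurableType d} {R : realType} (f : T -> R) :
  measurable_fun [set: T] f -> (forall x, 0 <= f x) ->
  measurable_fun [set: T] (fun x => (f x)^-1).
Proof.
move=> mf f0; rewrite (_ : (fun _ => _) = (@powR R ^~ (-1)) \o f).
  by apply: measurableT_comp => //; exact: measurable_powR.
by apply/funext => x /=; rewrite powR_inv1.
Qed.

Section bellman.
Context {d : measure_display} {X : measurableType d} {R : realType}.
Variables (P0 : probability X R) (p0 p1 : X -> R).
Hypotheses (mp0 : measurable_fun [set: X] p0) (mp1 : measurable_fun [set: X] p1).
Hypotheses (p0_ge0 : forall x, 0 <= p0 x) (p1_ge0 : forall x, 0 <= p1 x).
Variable rho : R -> nat -> R.
Hypothesis mrho : forall n, measurable_fun [set: R] (rho ^~ n).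
Hypothesis rho_itv : forall z n, 0 <= z -> 0 <= rho z n <= 1.
Hypothesis rho0 : forall z, 0 <= z -> rho z 0%N = g z.
Hypothesis rhoE : forall z n, 0 <= z -> (1 <= n)%N ->
  (g z - rho z n) / n%:R
  = sup [set gain P0 p0 p1 rho z m | m in [set m | (n <= m)%N]].

Local Notation lr x := (p1 x / p0 x).

Lemma lr_ge0 x : 0 <= lr x.
Proof. by rewrite divr_ge0. Qed.

Lemma measurable_lr : measurable_fun [set: X] (fun x => lr x).
Proof.
by apply: measurable_funM => //; exact: measurable_fun_ge0V.
Qed.

Lemma integrable_rho z n :
  0 <= z -> P0.-integrable setT (EFin \o (fun x => rho (z * lr x) n)).
Proof.
move=> z0; apply: measurable_bounded_integrable => //.
- by rewrite (@le_lt_trans _ _ 1%E) ?probability_le1// ltry.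
- apply: (measurableT_comp (mrho n)); apply: measurable_funM => //.
  exact: measurable_lr.
- exists 1; split=> // M M1 x _ /=.
  have /andP[r0 r1] := rho_itv n (mulr_ge0 z0 (lr_ge0 x)).
  by rewrite ger0_norm// (le_trans r1)// ltW.
Qed.

Definition next_rho z n : R := \int[P0]_x rho (z * lr x) n.

Lemma integrable_rho_comb z n m (p q : R) : 0 <= z ->
  P0.-integrable setT
    (EFin \o (fun x => p * rho (z * lr x) n + q * rho (z * lr x) m)).
Proof.
move=> z0.
rewrite (_ : _ \o _ = (fun x => p%:E * (rho (z * lr x) n)%:E
                                + q%:E * (rho (z * lr x) m)%:E)%E)//.
by apply: integrableD => //; apply: integrableZl => //; exact: integrable_rho.
Qed.

Lemma next_rho_comb z n m (p q : R) : 0 <= z ->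
  \int[P0]_x (p * rho (z * lr x) n + q * rho (z * lr x) m)
  = p * next_rho z n + q * next_rho z m.
Proof.
move=> z0.
have int k r : P0.-integrable setT (EFin \o (fun x => r * rho (z * lr x) k)).
  exact: (integrableZl measurableT r (integrable_rho k z0)).
by rewrite RintegralD//= !RintegralZl//; exact: integrable_rho.
Qed.

Lemma next_rho_itv z n : 0 <= z -> 0 <= next_rho z n <= 1.
Proof.
move=> z0.
have r x := rho_itv n (mulr_ge0 z0 (lr_ge0 x)).
apply/andP; split; first by apply: Rintegral_ge0 => x _; case/andP: (r x).
rewrite [leRHS](_ : _ = \int[P0]_(x in setT) 1); last first.
  rewrite Rintegral_cst// mul1r; exact/esym/(congr1 fine (probability_setT P0)).
apply: le_Rintegral => //; first exact: integrable_rho.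
- by apply: finite_measure_integrable_cst.
- by move=> x _; case/andP: (r x).
Qed.

Definition saving z n := g z - rho z n.
Definition next_saving z n := g z - next_rho z n.-1.

Lemma interp_saving z c : interp (saving z) c = g z - interp (rho z) c.
Proof. by rewrite /interp /saving; ring. Qed.

Lemma gainE z m : gain P0 p0 p1 rho z m = next_saving z m / m%:R.
Proof. by []. Qed.

Lemma interp_next_saving z m : 1 <= m ->
  interp (next_saving z) m = g z - interp (next_rho z) (m - 1).
Proof. by move=> m1; rewrite interp_subr1// /interp /next_saving; ring. Qed.

Lemma next_saving_itv z n : 0 <= z -> -1 <= next_saving z n <= 1.
Proof.
move=> z0; have := g_itv z0; have := next_rho_itv n.-1 z0.
by rewrite /next_saving; lra.
Qed.

Lemma has_sup_gain z n : 0 <= z -> (1 <= n)%N ->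
  has_sup [set gain P0 p0 p1 rho z m | m in [set m | (n <= m)%N]].
Proof.
move=> z0 n1; split; first by exists (gain P0 p0 p1 rho z n); exists n => /=.
exists 1 => _ [m /= nm <-]; rewrite gainE.
have m1 : 1 <= m%:R :> R by rewrite ler1n (leq_trans n1).
rewrite ler_pdivrMr ?mul1r; last lra.
by have := next_saving_itv m z0; lra.
Qed.

Lemma saving0 z : 0 <= z -> saving z 0 = 0.
Proof. by move=> z0; rewrite /saving rho0// subrr. Qed.

Lemma next_saving_le z n m : 0 <= z -> (1 <= n <= m)%N ->
  n%:R * next_saving z m <= m%:R * saving z n.
Proof.
move=> z0 /andP[n1 nm]; have n0 : 0 < n%:R :> R by rewrite ltr0n.
have m0 : 0 < m%:R :> R by rewrite ltr0n (leq_trans n1).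
have H : next_saving z m / m%:R <= saving z n / n%:R.
  rewrite -gainE /saving rhoE//.
  by apply: ub_le_sup; [case: (has_sup_gain z0 n1)|exists m].
by move: H; rewrite ler_pdivrMr// mulrAC ler_pdivlMr// mulrC (mulrC m%:R).
Qed.

Lemma saving_le z n (M : R) : 0 <= z -> (1 <= n)%N ->
  (forall m, (n <= m)%N -> n%:R * next_saving z m <= m%:R * M) -> saving z n <= M.
Proof.
move=> z0 n1 H; have n0 : 0 < n%:R :> R by rewrite ltr0n.
rewrite -(ler_pM2r (x := n%:R^-1)) ?invr_gt0// /saving rhoE//.
apply: ge_sup; first by case: (has_sup_gain z0 n1).
move=> _ [m /= nm <-]; rewrite gainE.
have m0 : 0 < m%:R :> R by rewrite ltr0n (leq_trans n1).
by rewrite ler_pdivrMr// mulrAC ler_pdivlMr// mulrC (mulrC M) H.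
Qed.

Lemma saving_ratio z n m : 0 <= z -> (0 < n <= m)%N ->
  n%:R * saving z m <= m%:R * saving z n.
Proof.
move=> z0 /andP[n0 nm]; have m0 := leq_trans n0 nm.
have n0' : 0 < n%:R :> R by rewrite ltr0n.
have m0' : 0 < m%:R :> R by rewrite ltr0n.
rewrite mulrC -ler_pdivlMr//; apply: saving_le => // k mk.
rewrite (_ : k%:R * _ = m%:R * (k%:R * saving z n) / n%:R); last by ring.
rewrite ler_pdivlMr// -mulrA ler_pM2l// mulrC.
by apply: next_saving_le; rewrite ?n0 ?(leq_trans nm).
Qed.

(* The supremum over [m >= a] need not be attained. *)
Lemma saving_approx z a (e : R) : 0 <= z -> 0 < e ->
  exists m, [/\ (1 <= m)%N, (a <= m)%N &
    saving z a <= a%:R / m%:R * next_saving z m + e].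
Proof.
move=> z0 e0; case: a => [|a].
  by exists 1%N; split; rewrite ?saving0// !mul0r add0r ltW.
have a0 : 0 < a.+1%:R :> R by rewrite ltr0n.
have := sup_adherent (divr_gt0 e0 a0) (has_sup_gain z0 (ltn0Sn a)).
rewrite -rhoE// => -[_ [m /= am <-]]; rewrite gainE => H.
exists m; split => //; first exact: leq_trans am.
move: H; rewrite -mulrBl ltr_pdivrMr// -/(saving z a.+1) => /ltW.
by rewrite (_ : a.+1%:R / _ * _ = next_saving z m / m%:R * a.+1%:R); [lra|ring].
Qed.

Lemma saving_ge0 z n : 0 <= z -> 0 <= saving z n.
Proof.
move=> z0; case: n => [|n]; first by rewrite saving0.
apply/ler_addgt0Pr => e e0.
pose k := Num.truncn (n.+1%:R / e); pose m := (n.+1 + k.+1)%N.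
have m0 : 0 < m%:R :> R by rewrite ltr0n.
have nm : (1 <= n.+1 <= m)%N by rewrite /= leq_addr.
have := next_saving_le z0 nm.
have /andP[lo _] := next_saving_itv m z0.
have em : n.+1%:R <= m%:R * e.
  rewrite -ler_pdivrMr// natrD.
  have /ltW := truncnS_gt (n.+1%:R / e); have : 0 <= n.+1%:R :> R by [].
  by rewrite -/k; lra.
move=> H; rewrite -(ler_pM2l m0) mulr0 mulrDr.
have : n.+1%:R * -1 <= n.+1%:R * next_saving z m by rewrite ler_wpM2l.
lra.
Qed.

Lemma saving_le1 z n : 0 <= z -> saving z n <= 1.
Proof.
by move=> z0; have := g_itv z0; have := rho_itv n z0; rewrite /saving; lra.
Qed.

Lemma interp_rho_itv z c : 0 <= z -> 0 <= c -> 0 <= interp (rho z) c <= 1.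
Proof.
move=> z0 c0; rewrite -[X in X <= _ <= _](interp_cst 0 c).
rewrite -[X in _ <= _ <= X](interp_cst 1 c).
by rewrite !le_interp// => n _; have /andP[] := rho_itv n z0.
Qed.

Lemma interp_next_rho z c : 0 <= z ->
  interp (next_rho z) c = \int[P0]_x interp (rho (z * lr x)) c.
Proof. by move=> z0; rewrite /interp next_rho_comb. Qed.

Lemma bellman_le z c m : 0 <= z -> 0 <= c <= m -> 1 <= m ->
  c * (g z - interp (next_rho z) (m - 1)) <= m * interp (saving z) c.
Proof.
move=> z0 cm m1; rewrite -interp_next_saving//.
have /andP[c0 cm'] := cm.
apply: (@le_trans _ _ (c * interp (saving z) m)).
  rewrite ler_wpM2l// le_interp//; first lra.
  move=> n mn; have n0 : (0 < n)%N by rewrite (leq_trans _ mn)// truncn_gt0.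
  have := @next_saving_le z n n z0; rewrite n0 leqnn => /(_ isT).
  by rewrite ler_pM2l// ltr0n.
apply: interp_ratio => //; first by rewrite saving0.
by move=> i j; exact: saving_ratio.
Qed.

Lemma next_saving_comb_le z (n m : nat) (p q c M : R) : 0 <= z ->
  p + q = 1 -> (forall w, 0 <= w -> p * saving w n.-1 + q * saving w m.-1
                                    - interp (saving w) c <= M) ->
  p * next_saving z n + q * next_saving z m
    - (g z - interp (next_rho z) c) <= M.
Proof.
move=> z0 pq H; rewrite /next_saving.
rewrite (_ : _ - _ = interp (next_rho z) c
    - (p * next_rho z n.-1 + q * next_rho z m.-1)); last first.
  by rewrite (_ : p = 1 - q); [ring|rewrite -pq addrK].
rewrite interp_next_rho// -next_rho_comb// -RintegralB//; last 2 first.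
- exact: integrable_rho_comb.
- exact: integrable_rho_comb.
rewrite [leRHS](_ : _ = \int[P0]_(x in setT) M); last first.
  rewrite Rintegral_cst// -[LHS]mulr1; congr (_ * _).
  exact/esym/(congr1 fine (probability_setT P0)).
apply: le_Rintegral => //.
- rewrite (_ : _ \o _ = (fun x => (interp (rho (z * lr x)) c)%:E
    - (p * rho (z * lr x) n.-1 + q * rho (z * lr x) m.-1)%:E)%E)//.
  by apply: integrableB => //; exact: integrable_rho_comb.
- exact: finite_measure_integrable_cst.
- move=> x _; have := H _ (mulr_ge0 z0 (lr_ge0 x)).
  rewrite interp_saving /saving; set w := z * _; apply: le_trans.
  by rewrite (_ : p = 1 - q); [rewrite le_eqVlt; apply/orP; left; apply/eqP; ring
    |rewrite -pq addrK].
Qed.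

(* Iterating the optimality equation [k] times only leaves the policies that
   stop after time [k] unaccounted for, whence the error term [x / k]. *)
Lemma saving_almost_concave (k : nat) z (a b : nat) (p q : R) :
  0 <= z -> 0 <= p -> 0 <= q -> p + q = 1 ->
  k%:R * (p * saving z a + q * saving z b
          - interp (saving z) (p * a%:R + q * b%:R))
  <= p * a%:R + q * b%:R.
Proof.
elim: k z a b p q => [|k IH] z a b p q z0 p0' q0 pq.
  by rewrite mul0r addr_ge0// mulr_ge0.
set n := p * a%:R + q * b%:R.
have n0 : 0 <= n by rewrite addr_ge0// mulr_ge0.
apply/ler_addgt0Pr => e e0.
have e'0 : 0 < e / k.+1%:R by rewrite divr_gt0.
have [al [al1 aal Hal]] := saving_approx a z0 e'0.
have [be [be1 bbe Hbe]] := saving_approx b z0 e'0.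
set e' := e / _ in e'0 Hal Hbe.
have al0 : 0 < al%:R :> R by rewrite ltr0n.
have be0 : 0 < be%:R :> R by rewrite ltr0n.
pose sa := p * (a%:R / al%:R); pose sb := q * (b%:R / be%:R).
have sa0 : 0 <= sa by rewrite mulr_ge0// divr_ge0.
have sb0 : 0 <= sb by rewrite mulr_ge0// divr_ge0.
have saE : sa * al%:R = p * a%:R by rewrite /sa -mulrA divfK// gt_eqF.
have sbE : sb * be%:R = q * b%:R by rewrite /sb -mulrA divfK// gt_eqF.
have sap : sa <= p by rewrite ler_piMr// ler_pdivrMr// mul1r ler_nat.
have sbq : sb <= q by rewrite ler_piMr// ler_pdivrMr// mul1r ler_nat.
have LE : p * saving z a + q * saving z b
          <= sa * next_saving z al + sb * next_saving z be + e'.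
  have := ler_wpM2l p0' Hal; have := ler_wpM2l q0 Hbe.
  have -> : p * (a%:R / al%:R * next_saving z al + e') =
    sa * next_saving z al + p * e' by rewrite /sa; ring.
  have -> : q * (b%:R / be%:R * next_saving z be + e') =
    sb * next_saving z be + q * e' by rewrite /sb; ring.
  have : p * e' + q * e' = e' by rewrite -mulrDl pq mul1r.
  lra.
have interp0 : 0 <= interp (saving z) n.
  by rewrite -(interp_cst 0 n) le_interp// => i _; exact: saving_ge0.
have ke' : k.+1%:R * e' = e by rewrite /e' mulrCA divff ?mulr1// gt_eqF.
have k0 : 0 <= k.+1%:R :> R by [].
have [s0|s0] := eqVneq (sa + sb) 0.
  have sa00 : sa = 0 by lra.
  have sb00 : sb = 0 by lra.
  rewrite sa00 sb00 !mul0r !add0r in LE.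
  have := ler_wpM2l k0 LE; rewrite ke'.
  have : 0 <= k.+1%:R * interp (saving z) n by rewrite mulr_ge0.
  by rewrite mulrBr; lra.
set s := sa + sb in s0.
have {}s0 : 0 < s by rewrite lt_neqAle eq_sym s0 addr_ge0.
pose m := n / s.
have mE : sa / s * al%:R + sb / s * be%:R = m.
  rewrite /m /n -saE -sbE; field; exact: lt0r_neq0.
have pq' : sa / s + sb / s = 1 by rewrite -mulrDl divff// gt_eqF.
have pa0 : 0 <= sa / s by rewrite divr_ge0// ltW.
have pb0 : 0 <= sb / s by rewrite divr_ge0// ltW.
have al1' : 1 <= al%:R :> R by rewrite ler1n.
have be1' : 1 <= be%:R :> R by rewrite ler1n.
have m1 : 1 <= m.
  have := ler_wpM2l pa0 al1'; have := ler_wpM2l pb0 be1'.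
  by rewrite !mulr1 -mE; lra.
have nm : 0 <= n <= m.
  by rewrite n0 /m ler_pdivlMr// ler_piMr//; rewrite /s; lra.
have Hint : k.+1%:R * (sa / s * next_saving z al + sb / s * next_saving z be
    - (g z - interp (next_rho z) (m - 1))) <= m.
  rewrite mulrC -ler_pdivlMr ?ltr0n//; apply: next_saving_comb_le => // w w0.
  rewrite ler_pdivlMr ?ltr0n// mulrC.
  have Em : m - 1 = sa / s * al.-1%:R + sb / s * be.-1%:R.
    rewrite -mE -(prednK al1) -(prednK be1) -!natr1/= !mulrDr !mulr1.
    by rewrite addrACA pq' addrK.
  have := IH w al.-1 be.-1 _ _ w0 pa0 pb0 pq'; rewrite -Em -natr1.
  have I0 : 0 <= interp (saving w) (m - 1).
    by rewrite -(interp_cst 0 (m - 1)) le_interp// ?subr_ge0// => i _; exact: saving_ge0.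
  have := ler_wpM2l pa0 (saving_le1 al.-1 w0).
  have := ler_wpM2l pb0 (saving_le1 be.-1 w0).
  lra.
have := bellman_le z0 nm m1.
rewrite {1}(_ : n = m * s); last by rewrite /m divfK// gt_eqF.
rewrite -mulrA ler_pM2l; last lra.
move=> HB.
have H3 := ler_wpM2l (ltW s0) Hint.
rewrite (_ : s * m = n) in H3; last by rewrite /m mulrC divfK// gt_eqF.
have H4 : sa * next_saving z al + sb * next_saving z be =
  s * (sa / s * next_saving z al + sb / s * next_saving z be).
  by field; exact: lt0r_neq0.
have := ler_wpM2l k0 LE; rewrite [leRHS]mulrDr ke' H4.
have := ler_wpM2l k0 HB.
move: H3; lra.
Qed.

Lemma saving_concave z (a b : nat) (p q : R) :
  0 <= z -> 0 <= p -> 0 <= q -> p + q = 1 ->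
  p * saving z a + q * saving z b <= interp (saving z) (p * a%:R + q * b%:R).
Proof.
move=> z0 p_ge0 q_ge0 pq; rewrite leNgt; apply/negP; rewrite -subr_gt0 => D0.
set n := p * a%:R + q * b%:R in D0; set D := _ - _ in D0.
have := @saving_almost_concave (Num.truncn (n / D)).+1 z a b p q z0 p_ge0 q_ge0 pq.
by rewrite -/n -/D leNgt -ltr_pdivrMr// truncnS_gt.
Qed.

Section argmax.
Variables (z : R) (m0 : nat).
Hypotheses (z0 : 0 <= z) (m0_gt0 : (1 <= m0)%N).
Hypothesis m0_max : forall m, (1 <= m)%N ->
  gain P0 p0 p1 rho z m <= gain P0 p0 p1 rho z m0.

Lemma next_saving_argmax m : (1 <= m)%N ->
  m0%:R * next_saving z m <= m%:R * next_saving z m0.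
Proof.
move=> m1; have := m0_max m1; rewrite !gainE.
by rewrite ler_pdivrMr ?ltr0n// mulrAC ler_pdivlMr ?ltr0n// mulrC (mulrC m%:R).
Qed.

Lemma saving_le_argmax n : (n <= m0)%N ->
  m0%:R * saving z n = n%:R * next_saving z m0.
Proof.
case: n => [|n] nm0; first by rewrite saving0// mulr0 mul0r.
apply/eqP; rewrite eq_le next_saving_le// andbT.
have m00 : 0 < m0%:R :> R by rewrite ltr0n.
rewrite mulrC -ler_pdivlMr//; apply: saving_le => // m nm.
rewrite mulrA ler_pdivlMr// mulrCA -mulrA ler_pM2l ?ltr0n//.
by rewrite mulrC next_saving_argmax// (leq_trans _ nm).
Qed.

(* Beyond the maximizer [m0], concavity makes the ratio nonincreasing. *)
Lemma saving_ge_argmax n : (m0 <= n)%N -> saving z n = next_saving z n.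
Proof.
rewrite leq_eqVlt => /predU1P[<-|m0n].
  have /eqP := saving_le_argmax (leqnn m0).
  by rewrite -subr_eq0 -mulrBr mulf_eq0 subr_eq0 pnatr_eq0 -leqn0 leqNgt m0_gt0
    => /eqP.
have n0 : (0 < n)%N by rewrite (leq_trans _ m0n).
have n0' : 0 < n%:R :> R by rewrite ltr0n.
apply/eqP; rewrite eq_le; apply/andP; split; last first.
  by have := @next_saving_le z n n z0; rewrite n0 leqnn ler_pM2l//; exact.
apply: saving_le => // m; rewrite leq_eqVlt => /predU1P[<-//|nm].
have m1 : (0 < m)%N by rewrite (leq_trans _ nm).
have D0 : 0 < m%:R - m0%:R :> R by rewrite subr_gt0 ltr_nat (ltn_trans m0n).
pose p : R := (m%:R - n%:R) / (m%:R - m0%:R).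
pose q : R := (n%:R - m0%:R) / (m%:R - m0%:R).
have p_ge0 : 0 <= p by rewrite divr_ge0 ?(ltW D0)// subr_ge0 ler_nat ltnW.
have q_ge0 : 0 <= q by rewrite divr_ge0 ?(ltW D0)// subr_ge0 ler_nat ltnW.
have pq : p + q = 1 by rewrite /p /q; field; exact: lt0r_neq0.
have pE : p * m0%:R + q * m%:R = n%:R by rewrite /p /q; field; exact: lt0r_neq0.
have /(next_saving_comb_le z0 pq) : forall w, 0 <= w ->
    p * saving w m0.-1 + q * saving w m.-1 - interp (saving w) n.-1%:R <= 0.
  move=> w w0; rewrite subr_le0.
  suff -> : n.-1%:R = p * m0.-1%:R + q * m.-1%:R by exact: saving_concave.
  have predE k : (0 < k)%N -> k.-1%:R = k%:R - 1 :> R.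
    by move=> k0; rewrite -[in RHS](prednK k0) -natr1 addrK.
  by rewrite !predE// -pE !mulrBr !mulr1; lra.
rewrite interp_nat -/(next_saving z n) subr_le0 => H.
have H1 := ler_wpM2l p_ge0 (next_saving_argmax m1).
have H2 := ler_wpM2l (ler0n R m) H.
rewrite (_ : n%:R * _ = p * (m0%:R * next_saving z m) + q * (m%:R * next_saving z m)).
  by apply: le_trans H2; lra.
by rewrite -pE; ring.
Qed.

Lemma bellman_eq c (m := Num.max c m0%:R) : 0 <= c ->
  c * (g z - interp (next_rho z) (m - 1)) = m * interp (saving z) c.
Proof.
move=> c0; have m0_ge1 : 1 <= m0%:R :> R by rewrite ler1n.
have m1 : 1 <= m by rewrite /m le_max m0_ge1 orbT.
rewrite -interp_next_saving// /m; have [cm|mc] := ltP c m0%:R.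
  rewrite interp_nat /interp.
  have tm : (Num.truncn c < m0)%N by rewrite truncn_lt_nat.
  have Hu := saving_le_argmax (ltnW tm); have Hv := saving_le_argmax tm.
  by rewrite [RHS]mulrDr (mulrCA m0%:R) Hu (mulrCA m0%:R _ (saving _ _)) Hv; ring.
congr (_ * _); rewrite /interp !saving_ge_argmax//.
  by rewrite (leq_trans _ (leqnSn _))// truncn_ge_nat.
by rewrite truncn_ge_nat.
Qed.

End argmax.

End bellman.

(** * Independent sequences *)

Section sequences_of_observations.
Context {d : measure_display} {X : measurableType d} {R : realType}.
Implicit Types (P : probability X R) (Q : probability (seqspace X) R).

Lemma measurable_coord n : measurable_fun [set: seqspace X] (fun x => x n).
Proof.
move=> _ A mA; rewrite setTI; apply: sub_sigma_algebra.
by exists n; exists A.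
Qed.

Lemma measurable_fun_seqP {d'} {T : measurableType d'} (f : T -> seqspace X) :
  (forall n, measurable_fun [set: T] (fun t => f t n)) ->
  measurable_fun [set: T] f.
Proof.
move=> mf.
apply: (@measurability _ _ T (seqspace X) setT f (@cylinders d X)) => //.
move=> _ [_ [n [A mA ->]] <-].
exact: (mf n).
Qed.

Lemma measurable_observed n : measurable_fun [set: seqspace X] (observed n).
Proof.
apply/measurable_fun_tnthP => i.
rewrite (_ : _ \o _ = (fun x : seqspace X => x i)); first exact: measurable_coord.
by apply/funext => x /=; rewrite tnth_mktuple.
Qed.

Definition rectangle n (A : nat -> set X) : set (seqspace X) :=
  [set x | forall i, (i < n)%N -> A i (x i)].

Lemma measurable_rectangle n A : (forall i, measurable (A i)) ->
  measurable (rectangle n A).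
Proof.
move=> mA; rewrite (_ : rectangle n A = \bigcap_(i in `I_n) [set x | A i (x i)]).
  apply: bigcap_measurableType => i _.
  rewrite -[X in measurable X]setTI; exact: measurable_coord.
by [].
Qed.

Lemma rectangle_measure_unique (m1 m2 : {measure set (seqspace X) -> \bar R}) :
  (m1 setT < +oo)%E ->
  (forall n A, (forall i, measurable (A i)) ->
    m1 (rectangle n A) = m2 (rectangle n A)) ->
  forall B, measurable B -> m1 B = m2 B.
Proof.
move=> m1T m12.
pose G : set (set (seqspace X)) := [set C | exists n, exists2 A,
  (forall i, measurable (A i)) & C = rectangle n A].
apply: (measure_unique G (fun=> setT)).
- rewrite eqEsubset; split; apply: smallest_sub; try exact: smallest_sigma_algebra.
  + move=> _ [n [A mA ->]]; apply: sub_sigma_algebra.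
    exists n.+1; exists (fun i => if i == n then A else setT).
      by move=> i; case: ifP.
    apply/seteqP; split => [x Ax i|x /(_ n (leqnn _))]; last by rewrite eqxx.
    by case: eqP => // ->.
  + by move=> _ [n [A mA ->]]; exact: measurable_rectangle.
- move=> _ _ [n [A mA ->]] [m [B mB ->]].
  exists (maxn n m).
  exists (fun i => (if (i < n)%N then A i else setT)
                   `&` (if (i < m)%N then B i else setT)).
    by move=> i; apply: measurableI; case: ifP.
  apply/seteqP; split => [x [Ax Bx] i _|x ABx].
    by split; case: ifP => // im; [exact: Ax|exact: Bx].
  split => i im; have := ABx i; rewrite leq_max im ?orbT => /(_ isT) [].
    by [].
  by [].
- by move=> _; exists 0%N; exists (fun=> setT) => //; apply/seteqP.
- by rewrite bigcup_const//; exists 0%N.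
- by move=> _ [n [A mA ->]]; exact: m12.
- by [].
Qed.

Definition set_coord (t : nat) (x : seqspace X) (y : X) : seqspace X :=
  fun i => if i == t then y else x i.

Lemma measurable_set_coord t :
  measurable_fun [set: seqspace X * X] (fun xy => set_coord t xy.1 xy.2).
Proof.
apply: measurable_fun_seqP => n; rewrite /set_coord; case: (n == t).
  exact: measurable_snd.
exact: (measurableT_comp (measurable_coord n) measurable_fst).
Qed.

Lemma observed_set_coord n t x y : (n <= t)%N ->
  observed n (set_coord t x y) = observed n x.
Proof.
move=> nt; apply: eq_from_tnth => i; rewrite !tnth_mktuple /set_coord.
by rewrite ltn_eqF// (leq_trans (ltn_ord i)).
Qed.

Lemma iid_law_resample P Q t : iid_law P Q ->
  forall B, measurable B ->
  (Q \x P)%E [set xy | B (set_coord t xy.1 xy.2)] = Q B.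
Proof.
move=> QP B mB.
pose phi (xy : seqspace X * X) := set_coord t xy.1 xy.2.
have mphi : measurable_fun setT phi := measurable_set_coord t.
pose pushm : {measure set (seqspace X) -> \bar R} :=
  pushforward (Q \x P)%E phi.
pose m' := pushm mphi.
suff : m' B = Q B by [].
apply: (@rectangle_measure_unique m' Q) => //.
  rewrite /= /pushforward preimage_setT -setXTT product_measure1E//.
  by rewrite [X in (X * _)%E]probability_setT [X in (_ * X)%E]probability_setT
     mule1 ltry.
move=> n A mA; rewrite /= /pushforward.
pose A' i := if i == t then setT else A i.
pose C := if (t < n)%N then A t else setT.
have mA' i : measurable (A' i) by rewrite /A'; case: ifP.
have mC : measurable C by rewrite /C; case: ifP.
rewrite (_ : _ @^-1` _ = rectangle n A' `*` C); last first.
  apply/seteqP; split => [[x y] /= H|[x y] /= [Hx Hy] i ni].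
    split => [i ni|].
      rewrite /A'; case: ifPn => // /negbTE it.
      by have := H i ni; rewrite /phi /set_coord it.
    by rewrite /C; case: ifP => // /H; rewrite /phi /set_coord eqxx.
  rewrite /phi /set_coord/=; case: eqP => [it|/eqP/negbTE it].
    by move: Hy; rewrite /C -it ni.
  by have := Hx i ni; rewrite /A' it.
rewrite product_measure1E//; last exact: measurable_rectangle.
rewrite /rectangle [X in (X * _)%E](QP n A' mA') (QP n A mA).
rewrite -[X in (_ * X)%E = _]fineK ?fin_num_measure//.
rewrite -EFinM; congr EFin.
rewrite /C; case: ltnP => [tn|nt].
  rewrite (bigD1 (Ordinal tn))//= [RHS](bigD1 (Ordinal tn))//= {1}/A' eqxx.
  rewrite [X in fine X * _]probability_setT mul1r mulrC; congr (_ * _).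
  apply: eq_bigr => i.
  by rewrite -val_eqE /A' => /negbTE /= ->.
rewrite [X in fine X]probability_setT mulr1; apply: eq_bigr => i _.
by rewrite /A' ltn_eqF// (leq_trans (ltn_ord i)).
Qed.

Lemma ge0_integral_resample P Q t (f : seqspace X -> \bar R) : iid_law P Q ->
  measurable_fun setT f -> (forall x, 0 <= f x)%E ->
  (\int[Q]_x f x = \int[Q]_x \int[P]_y f (set_coord t x y))%E.
Proof.
move=> QP mf f0.
pose phi (xy : seqspace X * X) := set_coord t xy.1 xy.2.
have mphi : measurable_fun setT phi := measurable_set_coord t.
pose pushm : {measure set (seqspace X) -> \bar R} :=
  pushforward (Q \x P)%E phi.
pose m' := pushm mphi.
rewrite (@eq_measure_integral _ _ _ _ m'); last first.
  by move=> A mA _; rewrite /= /pushforward -(iid_law_resample t QP mA).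
rewrite ge0_integral_pushforward// preimage_setT.
rewrite (fubini_tonelli1 (f \o phi))//; first exact: measurableT_comp.
by move=> x; exact: f0.
Qed.

Lemma measurable_integral_resample P t (f : seqspace X -> \bar R) :
  measurable_fun setT f -> (forall x, 0 <= f x)%E ->
  measurable_fun setT (fun x => \int[P]_y f (set_coord t x y))%E.
Proof.
move=> mf f0.
pose phi (xy : seqspace X * X) := set_coord t xy.1 xy.2.
apply: (measurable_fun_fubini_tonelli_F (m2 := P) (f \o phi)).
  by apply: measurableT_comp => //; exact: measurable_set_coord.
by move=> x; exact: f0.
Qed.

End sequences_of_observations.

(** * Change of measure *)

Section density.
Context {d : measure_display} {T : measurableType d} {R : realType}.
Variables (nu mu : {measure set T -> \bar R}) (p : T -> R).
Hypotheses (mp : measurable_fun [set: T] p) (p_ge0 : forall x, 0 <= p x).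
Hypothesis nuE : forall A, measurable A -> nu A = (\int[mu]_(x in A) (p x)%:E)%E.

Import HBNNSimple.

Lemma ge0_integral_density (f : T -> \bar R) :
  measurable_fun setT f -> (forall x, 0 <= f x)%E ->
  (\int[nu]_x f x = \int[mu]_x (f x * (p x)%:E))%E.
Proof.
move=> mf f0; pose h := nnsfun_approx measurableT mf.
have mh n : measurable_fun setT (EFin \o h n).
  by apply/measurable_EFinP; exact: measurable_funP.
have mpE : measurable_fun setT (EFin \o p) by exact/measurable_EFinP.
have nd_h x a b : (a <= b)%N -> ((h a x)%:E <= (h b x)%:E)%E.
  by move=> ab; rewrite lee_fin; exact/lefP/nd_nnsfun_approx.
have -> : (\int[nu]_x f x = lim (\int[nu]_x (h n x)%:E @[n --> \oo]))%E.
  rewrite -monotone_convergence//.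
  - apply: eq_integral => x _; apply/esym/cvg_lim => //.
    exact: cvg_nnsfun_approx.
  - by move=> n x _; rewrite lee_fin.
  - by move=> x _ a b /(nd_h x).
have -> : (\int[mu]_x (f x * (p x)%:E)
    = lim (\int[mu]_x ((h n x)%:E * (p x)%:E) @[n --> \oo]))%E.
  rewrite -monotone_convergence//.
  - apply: eq_integral => x _; apply/esym/cvg_lim => //; apply: cvgeZr => //.
    exact: cvg_nnsfun_approx.
  - by move=> n; apply: emeasurable_funM; [exact: mh|exact: mpE].
  - by move=> n x _; rewrite mule_ge0// lee_fin.
  - by move=> x _ a b /(nd_h x); apply: lee_wpmul2r; rewrite lee_fin.
congr (lim (_ @ \oo)); apply/funext => n.
have mI r : measurable_fun setT (fun x => (r * \1_(h n @^-1` [set r]) x)%:E).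
  by apply/measurable_EFinP; exact: measurable_funM.
transitivity (\int[nu]_x
   (\sum_(y \in range (h n)) (y * \1_(h n @^-1` [set y]) x)%:E))%E.
  by apply: eq_integral => x _; rewrite fimfunE -fsumEFin.
rewrite ge0_integral_fsum//; last by move=> r x _; exact: nnfun_muleindic_ge0.
transitivity (\int[mu]_x (\sum_(y \in range (h n))
    (y * \1_(h n @^-1` [set y]) x)%:E * (p x)%:E))%E; last first.
  apply: eq_integral => x _.
  rewrite -ge0_mule_fsuml => [|y]; last exact: nnfun_muleindic_ge0.
  by rewrite fsumEFin// -fimfunE.
rewrite ge0_integral_fsum//; last 2 first.
  - by move=> r; exact: emeasurable_funM.
  - by move=> r x _; rewrite mule_ge0 ?lee_fin// -lee_fin nnfun_muleindic_ge0.
apply: eq_fsbigr => r /[!inE] -[x0 _ hx0].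
have r0 : 0 <= r by rewrite -hx0.
under eq_integral do rewrite EFinM.
rewrite integralZl_indic_nnsfun// integral_indic// setIT.
under [RHS]eq_integral do rewrite EFinM -muleA.
rewrite ge0_integralZl//; last 2 first.
- by apply: emeasurable_funM => //; exact/measurable_EFinP.
- by move=> x _; rewrite mule_ge0 ?lee_fin.
congr (_ * _)%E; rewrite nuE//.
rewrite integral_mkcond; apply: eq_integral => x _.
by rewrite epatch_indic muleC.
Qed.

End density.

Section change_of_measure.
Context {d : measure_display} {X : measurableType d} {R : realType}.
Variables (P0 P1 : probability X R).
Variables (mu : {measure set X -> \bar R}) (p0 p1 : X -> R).
Hypotheses (dens0 : is_density mu P0 p0) (dens1 : is_density mu P1 p1).
Hypothesis abs_cont : P1 `<< P0.

Local Notation lr x := (p1 x / p0 x).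

Lemma density_lr A : measurable A -> P1 A = (\int[P0]_(x in A) (lr x)%:E)%E.
Proof.
move=> mA; have [mp0 p0_ge0 P0E] := dens0; have [mp1 p1_ge0 P1E] := dens1.
have mlr : measurable_fun setT (fun x => lr x) := measurable_lr mp0 mp1 p0_ge0.
have lr0 : forall x, 0 <= lr x := lr_ge0 p0_ge0 p1_ge0.
pose N := [set x | p0 x = 0].
have mN : measurable N.
  by rewrite -[X in measurable X]setTI; exact: (mp0 measurableT [set 0]).
have P1N : P1 (A `&` N) = 0%E.
  have mAN := measurableI _ _ mA mN.
  have /null_content_dominatesP H := abs_cont.
  apply: H => //; apply: (eq_trans (P0E _ mAN)).
  by rewrite integral0_eq// => x [_]; rewrite /N/= => ->.
rewrite integral_mkcond (ge0_integral_density mp0 p0_ge0 P0E)/=; last 2 first.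
- apply/(measurable_restrictT _ _).1 => //.
  by apply/measurable_EFinP; exact: measurable_funTS.
- by apply: erestrict_ge0 => x _; rewrite lee_fin.
rewrite (measureDI P1 mA mN) [X in (_ + X)%E]P1N adde0 [LHS]P1E; last exact: measurableD.
rewrite integral_mkcond; apply: eq_integral => x _; rewrite !patchE.
have [Nx|Nx] := pselect (N x).
  rewrite [X in (_ * X%:E)%E]Nx mule0 ifF//; apply/negbTE.
  by rewrite notin_setE => -[].
have -> : (x \in A `\` N) = (x \in A).
  by apply/idP/idP; rewrite !inE//; case.
case: ifP => _; last by rewrite mul0e.
by rewrite -EFinM divfK//; apply/eqP.
Qed.

Lemma ge0_integral_lr (f : X -> \bar R) :
  measurable_fun setT f -> (forall x, 0 <= f x)%E ->
  (\int[P1]_x f x = \int[P0]_x (f x * (lr x)%:E))%E.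
Proof.
move=> mf f0; have [mp0 p0_ge0 _] := dens0; have [mp1 p1_ge0 _] := dens1.
apply: ge0_integral_density => //; first exact: measurable_lr.
- exact: lr_ge0.
- exact: density_lr.
Qed.

Definition likelihood (t : nat) (x : seqspace X) : R :=
  \prod_(i < t) lr (x i).

Lemma measurable_likelihood t : measurable_fun [set: seqspace X] (likelihood t).
Proof.
have [mp0 p0_ge0 _] := dens0; have [mp1 p1_ge0 _] := dens1.
have mlr := measurable_lr mp0 mp1 p0_ge0.
rewrite /likelihood; apply: measurable_prod => i _.
exact: (measurableT_comp mlr (measurable_coord i)).
Qed.

Lemma likelihood_ge0 t x : 0 <= likelihood t x.
Proof.
have [mp0 p0_ge0 _] := dens0; have [mp1 p1_ge0 _] := dens1.
by apply: prodr_ge0 => i _; exact: lr_ge0.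
Qed.

Lemma likelihoodS t x : likelihood t.+1 x = likelihood t x * lr (x t).
Proof. by rewrite /likelihood big_ord_recr. Qed.

Lemma likelihood_set_coord t x y :
  likelihood t.+1 (set_coord t x y) = likelihood t x * lr y.
Proof.
rewrite likelihoodS /set_coord eqxx; congr (_ * _); apply: eq_bigr => i _.
by rewrite ltn_eqF.
Qed.

Lemma ge0_integral_likelihood (Q0 Q1 : probability (seqspace X) R) t
  (f : seqspace X -> \bar R) :
  iid_law P0 Q0 -> iid_law P1 Q1 ->
  measurable_fun setT f -> (forall x, 0 <= f x)%E ->
  (forall x y, (forall i, (i < t)%N -> x i = y i) -> f x = f y) ->
  (\int[Q1]_x f x = \int[Q0]_x (f x * (likelihood t x)%:E))%E.
Proof.
move=> iid0 iid1.
have [mp0 p0_ge0 _] := dens0; have [mp1 p1_ge0 _] := dens1.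
have mlr := measurable_lr mp0 mp1 p0_ge0.
have lr0 := lr_ge0 p0_ge0 p1_ge0.
elim: t f => [|t IH] f mf f0 fE.
  have [x0 _] : [set: seqspace X] !=set0.
    apply/set0P/eqP => E0; have := probability_setT Q0.
    by rewrite E0 measure0 => /esym/eqP; rewrite onee_eq0.
  have fc x : f x = f x0 by apply: fE.
  under eq_integral do rewrite fc.
  under [RHS]eq_integral do rewrite fc /likelihood big_ord0 mule1.
  rewrite !integral_cst//.
  by rewrite [X in (_ * X)%E]probability_setT [X in _ = (_ * X)%E]probability_setT.
have mfx x : measurable_fun setT (fun y => f (set_coord t x y)).
  apply: (measurableT_comp mf); apply: measurable_fun_seqP => n.
  rewrite /set_coord; case: (n == t) => //.
have mL := measurable_likelihood.
rewrite (ge0_integral_resample t iid1)// IH; last 3 first.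
- exact: measurable_integral_resample.
- by move=> x; exact: integral_ge0.
- move=> x y xy; apply: eq_integral => w _; apply: fE => i.
  by rewrite ltnS leq_eqVlt /set_coord; case: eqP => //= _; exact: xy.
rewrite [RHS](ge0_integral_resample t iid0)//; last 2 first.
- by apply: emeasurable_funM => //; apply/measurable_EFinP.
- by move=> x; rewrite mule_ge0// lee_fin likelihood_ge0.
apply: eq_integral => x _; rewrite ge0_integral_lr//.
rewrite muleC -ge0_integralZl//; last 3 first.
- by apply: emeasurable_funM => //; apply/measurable_EFinP.
- by move=> y _; rewrite mule_ge0// lee_fin.
- by rewrite lee_fin likelihood_ge0.
apply: eq_integral => y _; rewrite likelihood_set_coord.
by rewrite muleCA EFinM.
Qed.

End change_of_measure.

(** * The budget constraint *)

Section survival_sequence.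
Context {R : realType}.
Variable S : nat -> R.
Hypotheses (S0 : S 0%N = 1) (S_ge0 : forall n, 0 <= S n).
Hypothesis S_le : forall n, S n.+1 <= S n.

Let S_anti n m : (n <= m)%N -> S m <= S n.
Proof.
move=> /subnK <-; elim: (m - n)%N => [//|k IH].
by rewrite addSn (le_trans (S_le _)).
Qed.

Let stop_ge0 n : 0 <= S n - S n.+1. Proof. by rewrite subr_ge0. Qed.

Local Notation total := (\sum_(0 <= t <oo) (S t - S t.+1)%:E)%E.
Local Notation mean := (\sum_(0 <= t <oo) (t%:R * (S t - S t.+1))%:E)%E.

Let sum_stop N : \sum_(0 <= t < N) (S t - S t.+1) = 1 - S N.
Proof.
elim: N => [|N IH]; first by rewrite big_geq// S0 subrr.
by rewrite big_nat_recr//= IH; ring.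
Qed.

Let sum_time N : \sum_(0 <= t < N.+1) t%:R * (S t - S t.+1)
  = \sum_(0 <= t < N) S t.+1 - N%:R * S N.+1.
Proof.
elim: N => [|N IH]; first by rewrite big_nat1 big_geq// !mul0r subrr.
by rewrite big_nat_recr//= IH [in RHS]big_nat_recr//= -natr1; ring.
Qed.

Let total_ge N : ((1 - S N)%:E <= total)%E.
Proof.
rewrite -sum_stop -sumEFin; apply: nneseries_lim_ge => n _ _.
by rewrite lee_fin.
Qed.

Lemma stop_total_le1 : (total <= 1)%E.
Proof.
apply: lime_le; first by apply: is_cvg_nneseries => n _ _; rewrite lee_fin.
by apply: nearW => n; rewrite sumEFin sum_stop lee_fin gerBl.
Qed.

Let mean_ge0 : (0 <= mean)%E.
Proof. by apply: nneseries_ge0 => n _ _; rewrite lee_fin mulr_ge0. Qed.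

Lemma survival_sum_vanish c : (forall N, \sum_(0 <= t < N) S t.+1 <= c) ->
  forall e, 0 < e -> S (Num.truncn (c / e)).+1 <= e.
Proof.
move=> Sc e e0; set N := (Num.truncn (c / e)).+1.
have : N%:R * S N <= c.
  apply: le_trans (Sc N); rewrite -[N in N%:R]subn0 -sumr_const_nat mulr_suml.
  rewrite big_seq [leRHS]big_seq; apply: ler_sum => i.
  by rewrite mem_index_iota => /= iN; rewrite mul1r S_anti.
have N0 : 0 < N%:R :> R by rewrite ltr0n.
have : c < N%:R * e by rewrite -ltr_pdivrMr// truncnS_gt.
by move=> H1 H2; rewrite -(ler_pM2l N0) ltW// (le_lt_trans H2).
Qed.

Lemma expected_stop_le c : (forall N, \sum_(0 <= t < N) S t.+1 <= c) ->
  (mean + +oo * (1 - total) <= c%:E)%E.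
Proof.
move=> Sc; have -> : total = 1%E.
  apply/eqP; rewrite eq_le stop_total_le1/=; apply/lee_addgt0Pr => e e0.
  have SN := survival_sum_vanish Sc e0.
  apply: le_trans (leeD2r _ (total_ge (Num.truncn (c / e)).+1)).
  by rewrite -EFinD lee_fin; lra.
rewrite subee// mule0 adde0; apply: lime_le.
  by apply: is_cvg_nneseries => n _ _; rewrite lee_fin mulr_ge0.
apply: nearW => -[|N]; rewrite sumEFin lee_fin.
  by rewrite big_geq// (le_trans _ (Sc 0%N))// big_geq.
by rewrite sum_time (le_trans _ (Sc N))// gerBl mulr_ge0.
Qed.

Lemma expected_stop_ge c : (mean + +oo * (1 - total) <= c%:E)%E ->
  forall N, \sum_(0 <= t < N) S t.+1 <= c.
Proof.
move=> mc N.
have total1 : total = 1%E.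
  apply/eqP; rewrite eq_le stop_total_le1 leNgt; apply/negP => lt1.
  move: mc; rewrite gt0_mulye ?sube_gt0// addey ?leye_eq//.
  by rewrite gt_eqF// (lt_le_trans _ mean_ge0).
move: mc; rewrite total1 subee// mule0 adde0 => mc.
have timeE M : \sum_(0 <= t < M) S t.+1 - M%:R * S M.+1 <= c.
  rewrite -sum_time -lee_fin -sumEFin; apply: le_trans mc.
  by apply: nneseries_lim_ge => n _ _; rewrite lee_fin mulr_ge0.
apply/ler_addgt0Pr => e e0.
have N1 : 0 < N.+1%:R :> R by rewrite ltr0n.
have e'0 : 0 < e / N.+1%:R by rewrite divr_gt0.
have [M SM] : exists M, S M < e / N.+1%:R.
  apply/not_existsP => H.
  suff : (total <= (1 - e / N.+1%:R)%:E)%E.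
    by rewrite total1 lee_fin lerBrDr gerDl leNgt e'0.
  apply: lime_le; first by apply: is_cvg_nneseries => n _ _; rewrite lee_fin.
  apply: nearW => n; rewrite sumEFin sum_stop lee_fin lerB//.
  by have /negP := H n; rewrite -leNgt.
pose K := maxn N M.
have SK : S K.+1 <= e / N.+1%:R.
  by apply: le_trans (ltW SM); rewrite S_anti// ltnW// ltnS leq_maxr.
have := timeE K; rewrite (@big_cat_nat _ _ _ N)//=; last exact: leq_maxl.
have : (K - N)%:R * S K.+1 <= \sum_(N <= t < K) S t.+1.
  rewrite -sumr_const_nat mulr_suml.
  rewrite big_seq [leRHS]big_seq; apply: ler_sum => i.
  by rewrite mem_index_iota mul1r => /andP[_ iK]; rewrite S_anti// ltnW.
rewrite natrB ?leq_maxl//.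
have : N%:R * S K.+1 <= e.
  apply: (@le_trans _ _ (N%:R * (e / N.+1%:R))); first by rewrite ler_wpM2l.
  by rewrite mulrCA ger_pMr// ler_pdivrMr// mul1r ler_nat.
lra.
Qed.

End survival_sequence.

Section stopping_policies.
Context {d : measure_display} {X : measurableType d} {R : realType}.
Variable psi : policy X R.
Arguments psi : clear implicits.
Hypothesis psiP : is_policy psi.
Implicit Type x : seqspace X.

Definition survival (t : nat) x : R := \prod_(n < t) (1 - psi n (observed n x)).

Lemma survival0 x : survival 0 x = 1.
Proof. by rewrite /survival big_ord0. Qed.

Lemma survivalS t x :
  survival t.+1 x = survival t x * (1 - psi t (observed t x)).
Proof. by rewrite /survival big_ord_recr. Qed.

Lemma survival_ge0 t x : 0 <= survival t x.
Proof.
apply: prodr_ge0 => n _; rewrite subr_ge0.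
by have [_ /(_ (observed n x))/andP[]] := psiP n.
Qed.

Lemma survivalS_le t x : survival t.+1 x <= survival t x.
Proof.
rewrite survivalS ler_piMr ?survival_ge0// gerBl.
by have [_ /(_ (observed t x))/andP[]] := psiP t.
Qed.

Lemma stop_probE t x : stop_prob psi t x = survival t x - survival t.+1 x.
Proof. by rewrite survivalS /stop_prob -/(survival t x); ring. Qed.

Lemma stop_prob_ge0 t x : 0 <= stop_prob psi t x.
Proof. by rewrite stop_probE subr_ge0 survivalS_le. Qed.

Lemma survival_set_coord t n x y : (n <= t.+1)%N ->
  survival n (set_coord t x y) = survival n x.
Proof.
move=> nt; apply: eq_bigr => i _; rewrite observed_set_coord//.
by rewrite -ltnS (leq_trans (ltn_ord i)).
Qed.

Lemma measurable_policy t :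
  measurable_fun [set: seqspace X] (fun x => psi t (observed t x)).
Proof.
by have [mpsi _] := psiP t; exact: (measurableT_comp mpsi (@measurable_observed _ _ t)).
Qed.

Lemma measurable_survival t : measurable_fun [set: seqspace X] (survival t).
Proof.
apply: measurable_prod => n _; apply: measurable_funB => //.
exact: measurable_policy.
Qed.

Lemma measurable_stop_prob t :
  measurable_fun [set: seqspace X] (stop_prob psi t).
Proof.
by apply: measurable_funM; [exact: measurable_policy|exact: measurable_survival].
Qed.

Definition expected_time_at x : \bar R :=
  (\sum_(0 <= t <oo) (t%:R * stop_prob psi t x)%:E + +oo * never_prob psi x)%E.

Lemma measurable_expected_time_at :
  measurable_fun [set: seqspace X] expected_time_at.
Proof.
apply: emeasurable_funD.
  apply: ge0_emeasurable_sum => [t x _ _|t _].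
    by rewrite lee_fin mulr_ge0 ?stop_prob_ge0.
  by apply/measurable_EFinP; apply: measurable_funM => //; exact: measurable_stop_prob.
apply: measurable_funeM; apply: emeasurable_funB => //.
apply: ge0_emeasurable_sum => [t x _ _|t _]; first by rewrite lee_fin stop_prob_ge0.
by apply/measurable_EFinP; exact: measurable_stop_prob.
Qed.

Lemma expected_time_atE x : expected_time_at x =
  (\sum_(0 <= t <oo) (t%:R * (survival t x - survival t.+1 x))%:E
   + +oo * (1 - \sum_(0 <= t <oo) (survival t x - survival t.+1 x)%:E))%E.
Proof.
rewrite /expected_time_at /never_prob.
by congr (_ + +oo * (1 - _))%E; apply: eq_eseriesr => t _; rewrite stop_probE.
Qed.

Lemma expected_time_at_ge0 x : (0 <= expected_time_at x)%E.
Proof.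
rewrite expected_time_atE adde_ge0//.
  apply: nneseries_ge0 => t _ _.
  by rewrite lee_fin mulr_ge0// subr_ge0 survivalS_le.
apply: mule_ge0 => //; rewrite sube_ge0 ?orbT//.
apply: (@stop_total_le1 _ (survival ^~ x)).
- exact: survival0.
- by move=> n; exact: survival_ge0.
- by move=> n; exact: survivalS_le.
Qed.

(* The law of [X] ranges over all distributions, hence over the Dirac ones:
   the budget constraint holds along every single sequence. *)
Lemma uniform_budgetP c : uniform_budget c psi <->
  forall x N, \sum_(0 <= t < N) survival t.+1 x <= c.
Proof.
split=> [[_ H] x|H].
  apply: (@expected_stop_ge _ (survival ^~ x)).
  - exact: survival0.
  - by move=> n; exact: survival_ge0.
  - by move=> n; exact: survivalS_le.
  rewrite -expected_time_atE.
  have := H (@dirac _ (seqspace X) x R); rewrite /expected_time -/expected_time_at.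
  rewrite integral_dirac//; last exact: measurable_expected_time_at.
  by rewrite diracT mul1e.
split=> // Q; rewrite /expected_time -/expected_time_at.
apply: (@le_trans _ _ (\int[Q]_(x in setT) c%:E)%E); last first.
  by rewrite integral_cst// [X in (_ * X)%E]probability_setT mule1.
apply: ge0_le_integral => //.
- by move=> x _; exact: expected_time_at_ge0.
- exact: measurable_expected_time_at.
move=> x _; rewrite -/(expected_time_at x) expected_time_atE.
apply: (@expected_stop_le _ (survival ^~ x)) => //.
- exact: survival0.
- by move=> n; exact: survival_ge0.
- by move=> n; exact: survivalS_le.
Qed.

End stopping_policies.

(** * The risk of a stopping policy *)

Lemma measurable_g {R : realType} : measurable_fun [set: R] (@g R).
Proof. by apply: measurable_minr. Qed.

Section optimal_decision.
Context {d : measure_display} {X : measurableType d} {R : realType}.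
Variables (P0 P1 : probability X R).
Variables (mu : {measure set X -> \bar R}) (p0 p1 : X -> R).
Hypotheses (dens0 : is_density mu P0 p0) (dens1 : is_density mu P1 p1).
Hypothesis abs_cont : P1 `<< P0.
Variables Q0 Q1 : probability (seqspace X) R.
Hypotheses (iid0 : iid_law P0 Q0) (iid1 : iid_law P1 Q1).
Variables (z : R) (psi : policy X R).
Hypotheses (z_ge0 : 0 <= z) (psiP : is_policy psi).

Local Notation Lambda := (likelihood p0 p1).

Let mp0 : measurable_fun setT p0. Proof. by case: dens0. Qed.
Let mp1 : measurable_fun setT p1. Proof. by case: dens1. Qed.
Let p0_ge0 x : 0 <= p0 x. Proof. by case: dens0. Qed.
Let p1_ge0 x : 0 <= p1 x. Proof. by case: dens1. Qed.

Let mLambda t : measurable_fun setT (Lambda t).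
Proof. exact: measurable_likelihood dens0 dens1 t. Qed.

Let Lambda_ge0 t x : 0 <= Lambda t x.
Proof. exact: likelihood_ge0 dens0 dens1 t x. Qed.

Let mstop t : measurable_fun setT (stop_prob psi t).
Proof. exact: measurable_stop_prob. Qed.

Lemma eq_observed n t (x y : seqspace X) : (n <= t)%N ->
  (forall i, (i < t)%N -> x i = y i) -> observed n x = observed n y.
Proof.
move=> nt xy; apply: eq_from_tnth => i; rewrite !tnth_mktuple xy//.
exact: leq_trans nt.
Qed.

Lemma eq_stop_prob t (x y : seqspace X) : (forall i, (i < t)%N -> x i = y i) ->
  stop_prob psi t x = stop_prob psi t y.
Proof.
move=> xy; rewrite /stop_prob (eq_observed (leqnn t) xy); congr (_ * _).
by apply: eq_bigr => i _; rewrite (eq_observed (ltnW (ltn_ord i)) xy).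
Qed.

Lemma total_errorE (delta : policy X R) : is_policy delta ->
  (type1_error Q0 psi delta + z%:E * type2_error Q1 psi delta
   = \sum_(0 <= t <oo) \int[Q0]_x (stop_prob psi t x *
       (delta t (observed t x) + z * Lambda t x * (1 - delta t (observed t x))))%:E)%E.
Proof.
move=> deltaP.
have mdelta t := @measurable_policy _ _ _ _ deltaP t.
have delta01 t x : 0 <= delta t (observed t x) <= 1.
  by have [_] := deltaP t; exact.
have mstop2 t : measurable_fun setT
    (fun x => (stop_prob psi t x * (1 - delta t (observed t x)))%:E).
  apply/measurable_EFinP; apply: measurable_funM => //.
  exact: measurable_funB.
have stop2_ge0 t x : 0 <= stop_prob psi t x * (1 - delta t (observed t x)).
  by rewrite mulr_ge0 ?stop_prob_ge0// subr_ge0; case/andP: (delta01 t x).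
have mstop1 t : measurable_fun setT
    (fun x => (stop_prob psi t x * delta t (observed t x))%:E).
  by apply/measurable_EFinP; exact: measurable_funM.
have stop1_ge0 t x : 0 <= stop_prob psi t x * delta t (observed t x).
  by rewrite mulr_ge0 ?stop_prob_ge0//; case/andP: (delta01 t x).
rewrite /type1_error /type2_error.
rewrite integral_nneseries//; last by move=> t x _; rewrite lee_fin.
rewrite integral_nneseries//; last by move=> t x _; rewrite lee_fin.
rewrite -nneseriesZl; last by move=> t _; apply: integral_ge0 => x _; rewrite lee_fin.
rewrite -nneseriesD; last 2 first.
- by move=> t _ _; apply: integral_ge0 => x _; rewrite lee_fin.
- move=> t _ _; rewrite mule_ge0 ?lee_fin//.
  by apply: integral_ge0 => x _; rewrite lee_fin.
apply: eq_eseriesr => t _.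
rewrite (ge0_integral_likelihood dens0 dens1 abs_cont (t := t) iid0 iid1)//; last 2 first.
- by move=> x; rewrite lee_fin.
- by move=> x y xy; rewrite (eq_stop_prob xy) (eq_observed (leqnn t) xy).
have mL : measurable_fun setT (fun x => (Lambda t x)%:E) by exact/measurable_EFinP.
rewrite -ge0_integralZl//; last 2 first.
- exact: emeasurable_funM.
- by move=> x _; rewrite mule_ge0// lee_fin.
rewrite -ge0_integralD//; last 3 first.
- by move=> x _; rewrite lee_fin.
- by move=> x _; rewrite !mule_ge0// lee_fin.
- by apply: measurable_funeM; exact: emeasurable_funM.
apply: eq_integral => x _; rewrite -!EFinM -EFinD; congr EFin; ring.
Qed.

Definition likelihood_test : policy X R := fun t xs =>
  if 1 < z * \prod_(i < t) (p1 (tnth xs i) / p0 (tnth xs i)) then 1 else 0.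

Lemma likelihood_testE t x :
  likelihood_test (observed t x) = if 1 < z * Lambda t x then 1 else 0.
Proof.
rewrite /likelihood_test /likelihood.
by under eq_bigr do rewrite tnth_mktuple.
Qed.

Lemma likelihood_testP : is_policy likelihood_test.
Proof.
move=> t; split; last first.
  by move=> xs; rewrite /likelihood_test; case: ifP; rewrite lexx ler01.
apply: measurable_fun_ifT => //; apply: measurable_fun_ltr => //.
apply: measurable_funM => //; apply: measurable_prod => i _.
apply: (measurableT_comp (measurable_lr mp0 mp1 p0_ge0)).
exact: measurable_tnth.
Qed.

Lemma weighted_riskE : weighted_risk Q0 Q1 z psi =
  (\sum_(0 <= t <oo) \int[Q0]_x (stop_prob psi t x * g (z * Lambda t x))%:E)%E.
Proof.
have zL t x : 0 <= z * Lambda t x by rewrite mulr_ge0.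
apply/eqP; rewrite eq_le; apply/andP; split.
  apply: (@le_trans _ _ (type1_error Q0 psi likelihood_test
                         + z%:E * type2_error Q1 psi likelihood_test)%E).
    by apply: ereal_inf_lbound; exists likelihood_test => //; exact: likelihood_testP.
  rewrite total_errorE; last exact: likelihood_testP.
  rewrite le_eqVlt; apply/orP; left; apply/eqP.
  apply: eq_eseriesr => t _; apply: eq_integral => x _; congr (_ * _)%:E.
  rewrite likelihood_testE /g minEle; case: ltP => z1.
    by rewrite ltW// subrr mulr0 addr0.
  by case: leP => ?; lra.
apply: le_ereal_inf_tmp => _ [delta deltaP <-]; rewrite total_errorE//.
have mdelta t := @measurable_policy _ _ _ _ deltaP t.
have mzL t : measurable_fun setT (fun x => z * Lambda t x).
  exact: measurable_funM.
apply: lee_nneseries => [t _ _|t _].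
  apply: integral_ge0 => x _; rewrite lee_fin mulr_ge0 ?stop_prob_ge0//.
  by case/andP: (g_itv (zL t x)).
apply: ge0_le_integral => //.
- move=> x _; rewrite lee_fin mulr_ge0 ?stop_prob_ge0//.
  by case/andP: (g_itv (zL t x)).
- apply/measurable_EFinP; apply: measurable_funM => //.
  exact: (measurableT_comp measurable_g).
- apply/measurable_EFinP; apply: measurable_funM => //.
  apply: measurable_funD => //; apply: measurable_funM => //.
  exact: measurable_funB.
move=> x _; rewrite lee_fin ler_wpM2l ?stop_prob_ge0//.
have /andP[d0 d1] : 0 <= delta t (observed t x) <= 1 by have [_] := deltaP t; exact.
have := zL t x; rewrite /g; set y := _ * _; set e := delta _ _ in d0 d1 *.
move=> _; rewrite minEle; case: (leP 1 y) => y1.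
  have : 0 <= (y - 1) * (1 - e) by rewrite mulr_ge0 ?subr_ge0.
  lra.
have : 0 <= (1 - y) * e by rewrite mulr_ge0 ?subr_ge0// ltW.
lra.
Qed.

End optimal_decision.

(** * Verification *)

Section measurable_interpolation.
Context {d : measure_display} {T : measurableType d} {R : realType}.

Lemma measurable_fun_nat_index (f : nat -> T -> R) (N : T -> nat) :
  (forall n, measurable_fun [set: T] (f n)) ->
  (forall n, measurable (N @^-1` [set n])) ->
  measurable_fun [set: T] (fun x => f (N x) x).
Proof.
move=> mf mN; have -> : [set: T] = \bigcup_n (N @^-1` [set n]).
  by apply/seteqP; split => // x _; exists (N x).
apply/measurable_fun_bigcup => // n.
apply: (eq_measurable_fun (f n)); first by move=> x; rewrite inE /= => ->.
exact: measurable_funTS.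
Qed.

Lemma measurable_interp (a : T -> nat -> R) (c : T -> R) :
  (forall n, measurable_fun [set: T] (a ^~ n)) -> measurable_fun [set: T] c ->
  measurable_fun [set: T] (fun x => interp (a x) (c x)).
Proof.
move=> ma mc; rewrite /interp.
apply: (measurable_fun_nat_index (f := fun n x =>
  (n.+1%:R - c x) * a x n + (c x - n%:R) * a x n.+1)) => n.
  by apply: measurable_funD; apply: measurable_funM => //; apply: measurable_funB.
rewrite (_ : _ @^-1` _ = c @^-1` (Num.truncn @^-1` [set n]))//.
rewrite -[X in measurable X]setTI; apply: mc => //.
rewrite (_ : _ @^-1` _ = `]-oo, n.+1%:R[ `&` (if n is 0%N then setT else `[n%:R, +oo[)).
  by apply: measurableI => //; case: n.
apply/seteqP; split => x /=; rewrite !in_itv/=.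
  move=> <-; rewrite truncnS_gt; split=> //.
  case E : (Num.truncn x) => [//|k] /=.
  by rewrite in_itv/= andbT -truncn_gt_nat E.
rewrite -truncn_le_nat => -[xn nx]; apply/eqP; rewrite eqn_leq xn/=.
by case: n nx {xn} => //= k; rewrite in_itv/= andbT -truncn_gt_nat.
Qed.

End measurable_interpolation.

Section one_step.
Context {d : measure_display} {X : measurableType d} {R : realType}.
Variables (P0 : probability X R) (p0 p1 : X -> R).
Hypotheses (mp0 : measurable_fun [set: X] p0) (mp1 : measurable_fun [set: X] p1).
Hypotheses (p0_ge0 : forall x, 0 <= p0 x) (p1_ge0 : forall x, 0 <= p1 x).
Variable rho : R -> nat -> R.
Hypothesis mrho : forall n, measurable_fun [set: R] (rho ^~ n).
Hypothesis rho_itv : forall z n, 0 <= z -> 0 <= rho z n <= 1.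
Hypothesis rho0 : forall z, 0 <= z -> rho z 0%N = g z.
Hypothesis rhoE : forall z n, 0 <= z -> (1 <= n)%N ->
  (g z - rho z n) / n%:R
  = sup [set gain P0 p0 p1 rho z m | m in [set m | (n <= m)%N]].

Local Notation nrho := (next_rho P0 p0 p1 rho).

Lemma one_step_le z s s' c c' : 0 <= z -> 0 <= s' <= s -> 0 <= c -> 0 <= c' ->
  (0 < s' -> s' * (c' + 1) = s * c) ->
  s * interp (rho z) c <= (s - s') * g z + s' * interp (nrho z) c'.
Proof.
move=> z0 /andP[s'0 s's] c0 c'0 sc.
have s0 : 0 <= s := le_trans s'0 s's.
move: s'0; rewrite le_eqVlt => /predU1P[s'0|s'0].
  rewrite -s'0 subr0 mul0r addr0 ler_wpM2l//.
  rewrite -subr_ge0 -interp_saving -(interp_cst 0 c) le_interp// => n _.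
  exact: (saving_ge0 mp0 mp1 p0_ge0 p1_ge0 mrho rho_itv rho0 rhoE).
have {}sc := sc s'0.
have {}s0 : 0 < s := lt_le_trans s'0 s's.
have cpos : 0 < c.
  by rewrite -(pmulr_rgt0 _ s0) -sc mulr_gt0// ltr_wpDl.
have cm : 0 <= c <= c' + 1.
  by rewrite c0 -(ler_pM2l s'0) sc ler_wpM2r.
have m1 : 1 <= c' + 1 by rewrite lerDr.
have := bellman_le mp0 mp1 p0_ge0 p1_ge0 mrho rho_itv rho0 rhoE z0 cm m1.
rewrite addrK interp_saving -(ler_pM2l s'0) !mulrA sc (mulrC s') (mulrC s).
rewrite -!mulrA !(ler_pM2l cpos); lra.
Qed.

Lemma one_step_eq z s (m0 : nat) c (m := Num.max c m0%:R) :
  0 <= z -> (1 <= m0)%N ->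
  (forall k, (1 <= k)%N -> gain P0 p0 p1 rho z k <= gain P0 p0 p1 rho z m0) ->
  0 <= c ->
  s * interp (rho z) c
  = (s - s * (c / m)) * g z + s * (c / m) * interp (nrho z) (m - 1).
Proof.
move=> z0 m01 max c0.
have m_neq0 : m != 0 by rewrite gt_eqF// lt_max ltr0n m01 orbT.
have := bellman_eq mp0 mp1 p0_ge0 p1_ge0 mrho rho_itv rho0 rhoE z0 m01 max c0.
rewrite -/m interp_saving => E.
have : c / m * (g z - interp (nrho z) (m - 1)) = g z - interp (rho z) c.
  by rewrite mulrAC E mulrC mulKf.
move: (c / m) => r E'; rewrite -[interp (rho z) c](subKr (g z)) -E'; ring.
Qed.

End one_step.

Section verification.
Context {d : measure_display} {X : measurableType d} {R : realType}.
Variables (P0 : probability X R) (p0 p1 : X -> R).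
Hypotheses (mp0 : measurable_fun [set: X] p0) (mp1 : measurable_fun [set: X] p1).
Hypotheses (p0_ge0 : forall x, 0 <= p0 x) (p1_ge0 : forall x, 0 <= p1 x).
Variable rho : R -> nat -> R.
Hypothesis mrho : forall n, measurable_fun [set: R] (rho ^~ n).
Hypothesis rho_itv : forall z n, 0 <= z -> 0 <= rho z n <= 1.
Variables (Q0 : probability (seqspace X) R) (iid0 : iid_law P0 Q0).
Variables (z : R) (z_ge0 : 0 <= z) (psi : policy X R) (psiP : is_policy psi).

(* [C t x] is the expected time that the policy may still spend after [t]. *)
Variable C : nat -> seqspace X -> R.
Hypothesis mC : forall t, measurable_fun [set: seqspace X] (C t).
Hypothesis C_ge0 : forall t x, 0 <= C t x.
Hypothesis C_set_coord : forall t x y, C t.+1 (set_coord t x y) = C t.+1 x.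

Local Notation lr x := (p1 x / p0 x).
Local Notation zt t x := (z * likelihood p0 p1 t x).
Local Notation nrho := (next_rho P0 p0 p1 rho).

Let zt_ge0 t x : 0 <= zt t x.
Proof. by rewrite mulr_ge0// prodr_ge0// => i _; rewrite divr_ge0. Qed.

Let mzt t : measurable_fun [set: seqspace X] (fun x => zt t x).
Proof.
apply: measurable_funM => //; apply: measurable_prod => i _.
exact: (measurableT_comp (measurable_lr mp0 mp1 p0_ge0) (measurable_coord i)).
Qed.

Let msurv t := @measurable_survival _ _ _ _ psiP t.
Let surv0 t x := @survival_ge0 _ _ _ _ psiP t x.

Definition potential t (x : seqspace X) : R :=
  survival psi t x * interp (rho (zt t x)) (C t x).

Definition next_potential t (x : seqspace X) : R :=
  survival psi t.+1 x * interp (nrho (zt t x)) (C t.+1 x).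

Definition stopping_cost t (x : seqspace X) : R :=
  stop_prob psi t x * g (zt t x).

Lemma potential_ge0 t x : 0 <= potential t x.
Proof.
rewrite mulr_ge0//.
by have /andP[] := interp_rho_itv rho_itv (zt_ge0 t x) (C_ge0 t x).
Qed.

Lemma potential_le t x : potential t x <= survival psi t x.
Proof.
rewrite ler_piMr//.
by have /andP[] := interp_rho_itv rho_itv (zt_ge0 t x) (C_ge0 t x).
Qed.

Lemma measurable_potential t : measurable_fun [set: seqspace X] (potential t).
Proof.
apply: measurable_funM => //; apply: measurable_interp => // n.
exact: (measurableT_comp (mrho n)).
Qed.

Lemma stopping_cost_ge0 t x : 0 <= stopping_cost t x.
Proof.
rewrite mulr_ge0//; first exact: stop_prob_ge0.
by have /andP[] := g_itv (zt_ge0 t x).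
Qed.

Lemma measurable_stopping_cost t :
  measurable_fun [set: seqspace X] (stopping_cost t).
Proof.
apply: measurable_funM; first exact: measurable_stop_prob.
exact: (measurableT_comp measurable_g).
Qed.

Lemma integral_potential_set_coord t x :
  (\int[P0]_y (potential t.+1 (set_coord t x y))%:E = (next_potential t x)%:E)%E.
Proof.
have potE y : potential t.+1 (set_coord t x y) =
    survival psi t.+1 x * interp (rho (zt t x * lr y)) (C t.+1 x).
  by rewrite /potential survival_set_coord// C_set_coord likelihood_set_coord mulrA.
under eq_integral do rewrite potE EFinM.
have int := integrable_rho_comb P0 mp0 mp1 p0_ge0 p1_ge0 mrho rho_itv
  (Num.truncn (C t.+1 x)) (Num.truncn (C t.+1 x)).+1
  ((Num.truncn (C t.+1 x)).+1%:R - C t.+1 x) (C t.+1 x - (Num.truncn (C t.+1 x))%:R)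
  (zt_ge0 t x).
rewrite integralZl// /next_potential EFinM; congr (_ * _)%E.
rewrite (interp_next_rho P0 mp0 mp1 p0_ge0 p1_ge0 mrho rho_itv)//.
by rewrite /Rintegral fineK//; exact: integrable_fin_num.
Qed.

Lemma integral_potentialS t :
  (\int[Q0]_x (potential t.+1 x)%:E = \int[Q0]_x (next_potential t x)%:E)%E.
Proof.
rewrite (ge0_integral_resample t iid0)//.
- by apply: eq_integral => x _; exact: integral_potential_set_coord.
- by apply/measurable_EFinP; exact: measurable_potential.
- by move=> x; rewrite lee_fin potential_ge0.
Qed.

Lemma measurable_next_potential t :
  measurable_fun [set: seqspace X] (next_potential t).
Proof.
apply/measurable_EFinP.
rewrite (_ : _ \o _ = (fun x => \int[P0]_y (potential t.+1 (set_coord t x y))%:E))%E.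
  apply: (@measurable_integral_resample _ _ _ P0 t (EFin \o potential t.+1)).
    by apply/measurable_EFinP; exact: measurable_potential.
  by move=> x; rewrite lee_fin potential_ge0.
by apply/funext => x; rewrite integral_potential_set_coord.
Qed.

Lemma next_potential_ge0 t x : 0 <= next_potential t x.
Proof.
rewrite -lee_fin -integral_potential_set_coord; apply: integral_ge0 => y _.
by rewrite lee_fin potential_ge0.
Qed.

Lemma integral_cost_potential t :
  (\int[Q0]_x (stopping_cost t x)%:E + \int[Q0]_x (potential t.+1 x)%:E
   = \int[Q0]_x (stopping_cost t x + next_potential t x)%:E)%E.
Proof.
rewrite integral_potentialS -ge0_integralD//.
- by move=> x _; rewrite lee_fin stopping_cost_ge0.
- by apply/measurable_EFinP; exact: measurable_stopping_cost.
- by move=> x _; rewrite lee_fin next_potential_ge0.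
- by apply/measurable_EFinP; exact: measurable_next_potential.
Qed.

Lemma cost_ge_potential N :
  (forall t x, potential t x <= stopping_cost t x + next_potential t x) ->
  (\int[Q0]_x (potential 0 x)%:E <=
   \sum_(0 <= t < N) \int[Q0]_x (stopping_cost t x)%:E
   + \int[Q0]_x (potential N x)%:E)%E.
Proof.
move=> H; elim: N => [|N IH]; first by rewrite big_geq// add0e.
apply: (le_trans IH); rewrite big_nat_recr//= -addeA leeD2l//.
rewrite integral_cost_potential; apply: ge0_le_integral => //.
- by move=> x _; rewrite lee_fin potential_ge0.
- by apply/measurable_EFinP; exact: measurable_potential.
- apply/measurable_EFinP; apply: measurable_funD.
    exact: measurable_stopping_cost.
  exact: measurable_next_potential.
- by move=> x _; rewrite lee_fin.
Qed.

Lemma cost_potential N :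
  (forall t x, potential t x = stopping_cost t x + next_potential t x) ->
  (\sum_(0 <= t < N) \int[Q0]_x (stopping_cost t x)%:E
   + \int[Q0]_x (potential N x)%:E = \int[Q0]_x (potential 0 x)%:E)%E.
Proof.
move=> H; elim: N => [|N IH]; first by rewrite big_geq// add0e.
rewrite -IH big_nat_recr//= -addeA integral_cost_potential; congr (_ + _)%E.
by apply: eq_integral => x _; rewrite H.
Qed.

Lemma total_cost_ge c :
  (forall t x, potential t x <= stopping_cost t x + next_potential t x) ->
  (forall x N, \sum_(0 <= t < N) survival psi t.+1 x <= c) ->
  (\int[Q0]_x (potential 0 x)%:E <=
   \sum_(0 <= t <oo) \int[Q0]_x (stopping_cost t x)%:E)%E.
Proof.
move=> H Sc; apply/lee_addgt0Pr => e e0.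
pose N := (Num.truncn (c / e)).+1.
apply: (le_trans (cost_ge_potential N H)); apply: leeD.
  apply: nneseries_lim_ge => t _ _; apply: integral_ge0 => x _.
  by rewrite lee_fin stopping_cost_ge0.
apply: (@le_trans _ _ (\int[Q0]_(x in setT) e%:E)%E); last first.
  by rewrite integral_cst// [X in (_ * X)%E]probability_setT mule1.
apply: ge0_le_integral => //.
- by move=> x _; rewrite lee_fin potential_ge0.
- by apply/measurable_EFinP; exact: measurable_potential.
- move=> x _; rewrite lee_fin; apply: (le_trans (potential_le N x)).
  apply: (@survival_sum_vanish _ (survival psi ^~ x)) => // n.
  exact: survivalS_le.
Qed.

Lemma total_cost_le :
  (forall t x, potential t x = stopping_cost t x + next_potential t x) ->
  (\sum_(0 <= t <oo) \int[Q0]_x (stopping_cost t x)%:E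
   <= \int[Q0]_x (potential 0 x)%:E)%E.
Proof.
move=> H; apply: lime_le.
  apply: is_cvg_nneseries => t _ _; apply: integral_ge0 => x _.
  by rewrite lee_fin stopping_cost_ge0.
apply: nearW => N; rewrite -(cost_potential N H) leeDl//.
by apply: integral_ge0 => x _; rewrite lee_fin potential_ge0.
Qed.

Lemma integral_potential0 c : (forall x, C 0 x = c) ->
  (\int[Q0]_x (potential 0 x)%:E = (interp (rho z) c)%:E)%E.
Proof.
move=> C0; under eq_integral do
  rewrite /potential survival0 C0 /likelihood big_ord0 mulr1 mul1r.
by rewrite integral_cst// [X in (_ * X)%E]probability_setT mule1.
Qed.

End verification.

(** * The optimal policy *)

Lemma measurable_fun_maxr0 {R : realType} {d} {T : measurableType d} (f : R -> T) :
  measurable_fun (`[0, +oo[%classic : set R) f ->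
  measurable_fun [set: R] (fun z => f (Num.max 0 z)).
Proof.
move=> mf; apply: (measurable_comp _ _ mf) => //.
- by move=> _ [z _ <-] /=; rewrite in_itv/= andbT le_max lexx.
- exact: measurable_maxr.
Qed.

Section test_statistic.
Context {d : measure_display} {X : measurableType d} {R : realType}.
Variables (p0 p1 : X -> R).
Hypotheses (mp0 : measurable_fun [set: X] p0) (mp1 : measurable_fun [set: X] p1).
Hypotheses (p0_ge0 : forall x, 0 <= p0 x) (p1_ge0 : forall x, 0 <= p1 x).
Variable mstar : R -> nat.
Hypothesis mmstar : measurable_fun (`[0, +oo[%classic : set R) mstar.
Hypothesis mstar_gt0 : forall z, 0 <= z -> (1 <= mstar z)%N.
Variables (z c : R).
Hypotheses (z_ge0 : 0 <= z) (c_ge0 : 0 <= c).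

Local Notation upd := (update p0 p1 mstar).
Local Notation stat := (statistic p0 p1 mstar z c).

Lemma foldl_update_ge0 (s : seq X) :
  0 <= (foldl upd (z, c) s).1 /\ 0 <= (foldl upd (z, c) s).2.
Proof.
elim/last_ind: s => [//|s x [IH1 IH2]]; rewrite foldl_rcons /update/=; split.
  by rewrite mulr_ge0// divr_ge0.
by rewrite subr_ge0 le_max ler1n mstar_gt0// orbT.
Qed.

Lemma measurable_mstar {d'} {T : measurableType d'} (f : T -> R) :
  measurable_fun [set: T] f -> (forall x, 0 <= f x) ->
  measurable_fun [set: T] (fun x => (mstar (f x))%:R : R).
Proof.
move=> mf f0.
have E : (fun x => (mstar (f x))%:R) =
    (fun n : nat => n%:R : R) \o ((fun w => mstar (Num.max 0 w)) \o f).
  by apply/funext => x /=; rewrite max_r.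
rewrite E; apply: measurableT_comp => //; apply: measurableT_comp => //.
exact: measurable_fun_maxr0.
Qed.

Lemma measurable_update_take t i : (i <= t)%N ->
  measurable_fun [set: t.-tuple X] (fun xs => (foldl upd (z, c) (take i xs)).1) /\
  measurable_fun [set: t.-tuple X] (fun xs => (foldl upd (z, c) (take i xs)).2).
Proof.
elim: i => [_|i IH it].
  split; [rewrite (_ : (fun _ => _) = cst z)|rewrite (_ : (fun _ => _) = cst c)];
    by [exact: measurable_cst|apply/funext => xs; rewrite take0].
have [m1 m2] := IH (ltnW it).
have E (xs : t.-tuple X) : foldl upd (z, c) (take i.+1 xs) =
    upd (foldl upd (z, c) (take i xs)) (tnth xs (Ordinal it)).
  have nE x0 : nth x0 xs i = tnth xs (Ordinal it) by rewrite (tnth_nth x0).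
  by rewrite (take_nth (tnth xs (Ordinal it))) ?size_tuple// foldl_rcons nE.
split; under eq_fun do rewrite E /update/=.
  apply: measurable_funM => //.
  exact: (measurableT_comp (measurable_lr mp0 mp1 p0_ge0) (measurable_tnth (Ordinal it))).
apply: measurable_funB => //; apply: measurable_maxr => //.
apply: measurable_mstar => // xs.
by case: (foldl_update_ge0 (take i xs)).
Qed.

Lemma measurable_statistic t :
  measurable_fun [set: t.-tuple X] (fun xs => (stat xs).1) /\
  measurable_fun [set: t.-tuple X] (fun xs => (stat xs).2).
Proof.
have := measurable_update_take (leqnn t).
have E (xs : t.-tuple X) : take t xs = xs by rewrite take_oversize// size_tuple.
by move=> [m1 m2]; split; under eq_fun do rewrite /statistic -E.
Qed.

Lemma psi_starE t (xs : t.-tuple X) : psi_star p0 p1 mstar z c xs =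
  1 - (stat xs).2 / Num.max (stat xs).2 (mstar (stat xs).1)%:R.
Proof. by rewrite /psi_star; case: (stat xs). Qed.

Lemma psi_star_policy : is_policy (psi_star p0 p1 mstar z c).
Proof.
move=> t; have [m1 m2] := measurable_statistic t; split.
  apply: (eq_measurable_fun (fun xs : t.-tuple X =>
      1 - (stat xs).2 / Num.max (stat xs).2 (mstar (stat xs).1)%:R)).
    by move=> xs _; rewrite psi_starE.
  apply: measurable_funB => //; apply: measurable_funM => //.
  apply: measurable_fun_ge0V; last by move=> xs; rewrite le_max ler0n orbT.
  apply: measurable_maxr => //.
  by apply: measurable_mstar => // xs; case: (foldl_update_ge0 xs).
move=> xs; rewrite psi_starE; have [z0 c0] := foldl_update_ge0 xs.
have M0 : 0 < Num.max (stat xs).2 (mstar (stat xs).1)%:R.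
  by rewrite lt_max ltr0n mstar_gt0 ?orbT.
rewrite subr_ge0 ler_pdivrMr// mul1r le_max lexx/= gerBl.
by rewrite divr_ge0// ltW.
Qed.

Lemma statistic0 x : stat (observed 0 x) = (z, c).
Proof. by rewrite /statistic [val (observed 0 x)]size0nil// size_tuple. Qed.

Lemma statisticS t x :
  stat (observed t.+1 x) = upd (stat (observed t x)) (x t).
Proof.
rewrite /statistic -foldl_rcons; congr foldl.
apply: (@eq_from_nth _ (x t)); first by rewrite size_rcons !size_tuple.
move=> i; rewrite size_tuple => it.
rewrite (nth_mktuple _ _ (Ordinal it)) -[LHS]/(x i) nth_rcons size_tuple.
move: it; rewrite ltnS leq_eqVlt => /predU1P[->|it].
  by rewrite ltnn eqxx.
by rewrite it (nth_mktuple _ _ (Ordinal it)).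
Qed.

Lemma statistic_likelihood t x :
  (stat (observed t x)).1 = z * likelihood p0 p1 t x.
Proof.
elim: t => [|t IH]; first by rewrite statistic0 /likelihood big_ord0 mulr1.
by rewrite statisticS likelihoodS mulrA -IH.
Qed.

Definition remaining_budget t (x : seqspace X) : R := (stat (observed t x)).2.

Definition star_horizon t (x : seqspace X) : R :=
  Num.max (remaining_budget t x) (mstar (z * likelihood p0 p1 t x))%:R.

Lemma star_horizon_gt0 t x : 0 < star_horizon t x.
Proof.
rewrite /star_horizon -statistic_likelihood lt_max ltr0n mstar_gt0 ?orbT//.
by case: (foldl_update_ge0 (observed t x)).
Qed.

Lemma remaining_budget_ge0 t x : 0 <= remaining_budget t x.
Proof. by case: (foldl_update_ge0 (observed t x)). Qed.

Lemma remaining_budgetS t x :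
  remaining_budget t.+1 x = star_horizon t x - 1.
Proof.
by rewrite /remaining_budget statisticS /= /star_horizon -statistic_likelihood.
Qed.

Lemma measurable_remaining_budget t :
  measurable_fun [set: seqspace X] (remaining_budget t).
Proof.
have [_ m2] := measurable_statistic t.
exact: (measurableT_comp m2 (@measurable_observed _ _ t)).
Qed.

Lemma remaining_budget_set_coord t x y :
  remaining_budget t.+1 (set_coord t x y) = remaining_budget t.+1 x.
Proof.
rewrite !remaining_budgetS /star_horizon /remaining_budget.
by rewrite -!statistic_likelihood observed_set_coord.
Qed.

Lemma survival_psi_star t x : survival (psi_star p0 p1 mstar z c) t.+1 x
  = survival (psi_star p0 p1 mstar z c) t x
    * (remaining_budget t x / star_horizon t x).
Proof.
rewrite survivalS psi_starE /star_horizon -statistic_likelihood.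
by rewrite subKr.
Qed.

Lemma sum_survival_psi_star t x :
  \sum_(0 <= s < t) survival (psi_star p0 p1 mstar z c) s.+1 x
  = c - survival (psi_star p0 p1 mstar z c) t x * remaining_budget t x.
Proof.
elim: t => [|t IH].
  by rewrite big_geq// survival0 /remaining_budget statistic0 mul1r subrr.
rewrite big_nat_recr//= IH remaining_budgetS survival_psi_star.
by field; rewrite gt_eqF// star_horizon_gt0.
Qed.

Lemma psi_star_budget : uniform_budget c (psi_star p0 p1 mstar z c).
Proof.
apply/uniform_budgetP; first exact: psi_star_policy.
move=> x N; rewrite sum_survival_psi_star gerBl mulr_ge0//.
  exact: survival_ge0 psi_star_policy N x.
exact: remaining_budget_ge0.
Qed.

End test_statistic.

Section remaining_budget_of_a_policy.
Context {d : measure_display} {X : measurableType d} {R : realType}.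
Variables (psi : policy X R) (c : R).
Hypothesis psi_budget : uniform_budget c psi.

Let psiP : is_policy psi. Proof. by case: psi_budget. Qed.

(* Where the test has stopped surely, the division by zero returns [0]. *)
Definition policy_budget t (x : seqspace X) : R :=
  (c - \sum_(0 <= s < t) survival psi s.+1 x) / survival psi t x.

Lemma policy_budget_ge0 t x : 0 <= policy_budget t x.
Proof.
rewrite divr_ge0 ?survival_ge0// subr_ge0.
exact: (uniform_budgetP psiP c).1.
Qed.

Lemma measurable_policy_budget t :
  measurable_fun [set: seqspace X] (policy_budget t).
Proof.
have msurv n := @measurable_survival _ _ _ _ psiP n.
apply: measurable_funM.
  by apply: measurable_funB => //; apply: measurable_sum.
by apply: measurable_fun_ge0V => // x; exact: survival_ge0.
Qed.

Lemma policy_budget_set_coord t x y :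
  policy_budget t.+1 (set_coord t x y) = policy_budget t.+1 x.
Proof.
rewrite /policy_budget survival_set_coord//; congr ((_ - _) / _).
rewrite big_nat [RHS]big_nat; apply: eq_bigr => i /andP[_ it].
by rewrite survival_set_coord.
Qed.

Lemma policy_budgetS t x : 0 < survival psi t.+1 x ->
  survival psi t.+1 x * (policy_budget t.+1 x + 1)
  = survival psi t x * policy_budget t x.
Proof.
move=> S1; have S0 := lt_le_trans S1 (survivalS_le psiP t x).
rewrite /policy_budget big_nat_recr//=; field.
by rewrite !gt_eqF.
Qed.

End remaining_budget_of_a_policy.

Theorem theorem4p9 (R : realType) (d : measure_display) (X : measurableType d)
    (P0 P1 : probability X R)
    (mu : {measure set X -> \bar R}) (p0 p1 : X -> R)
    (dens0 : is_density mu P0 p0) (dens1 : is_density mu P1 p1)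
    (abs_cont : P1 `<< P0)
    (KL_neq0 : KL_divergence P0 p0 p1 <> 0%E)
    (KL_fin : KL_divergence P0 p0 p1 \is a fin_num)
    (Q0 Q1 : probability (seqspace X) R)
    (iid0 : iid_law P0 Q0) (iid1 : iid_law P1 Q1)
    (rho : R -> nat -> R) (rhoP : solves_rho P0 p0 p1 rho)
    (mstar : R -> nat) (mstarP : argmax_gain P0 p0 p1 rho mstar)
    (z c : R) (z_ge0 : 0 <= z) (c_ge0 : 0 <= c) :
  let psi := psi_star p0 p1 mstar z c in
  uniform_budget c psi /\
  weighted_risk Q0 Q1 z psi
  = ereal_inf [set weighted_risk Q0 Q1 z psi' | psi' in uniform_budget c].
Proof.
move=> psi.
have [mp0 p0_ge0 _] := dens0; have [mp1 p1_ge0 _] := dens1.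
have [mrho rho_itv rho0 rhoE] := rhoP.
have [mmstar mstarM] := mstarP.
have mstar_gt0 w : 0 <= w -> (1 <= mstar w)%N by move=> /mstarM[].
have zL_ge0 t x : 0 <= z * likelihood p0 p1 t x.
  by rewrite mulr_ge0// (likelihood_ge0 dens0 dens1).
pose r w n := rho (Num.max 0 w) n.
have rK w : 0 <= w -> r w = rho w by move=> w0; rewrite /r max_r.
have gainK w m : 0 <= w -> gain P0 p0 p1 r w m = gain P0 p0 p1 rho w m.
  move=> w0; rewrite /gain; congr ((_ - _) / _); apply: eq_Rintegral => x _.
  by rewrite rK// mulr_ge0// divr_ge0.
have mr n : measurable_fun [set: R] (r ^~ n).
  exact: (measurable_fun_maxr0 (f := rho ^~ n)).
have r_itv w n : 0 <= w -> 0 <= r w n <= 1 by move=> w0; rewrite rK// rho_itv.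
have r0 w : 0 <= w -> r w 0%N = g w by move=> w0; rewrite rK// rho0.
have rE w n : 0 <= w -> (1 <= n)%N -> (g w - r w n) / n%:R
    = sup [set gain P0 p0 p1 r w m | m in [set m | (n <= m)%N]].
  move=> w0 n1; rewrite rK// rhoE//; congr sup; apply/eq_imagel => m _.
  by rewrite gainK.
have psiB : uniform_budget c psi by exact: psi_star_budget.
have psiP : is_policy psi by case: psiB.
split => //; apply/eqP; rewrite eq_le; apply/andP; split; last first.
  by apply: ereal_inf_lbound; exists psi.
rewrite (weighted_riskE dens0 dens1 abs_cont iid0 iid1 z_ge0 psiP).
apply: (@le_trans _ _ (interp (r z) c)%:E).
  pose C := remaining_budget p0 p1 mstar z c.
  have C0 x : C 0%N x = c by rewrite /C /remaining_budget statistic0.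
  rewrite -(integral_potential0 p0 p1 r Q0 z psi C0).
  apply: (total_cost_le mp0 mp1 p0_ge0 p1_ge0 mr r_itv iid0 z_ge0 psiP).
  - by move=> t; exact: measurable_remaining_budget.
  - by move=> t x; exact: remaining_budget_ge0.
  - by move=> t x y; exact: remaining_budget_set_coord.
  move=> t x; rewrite /potential /stopping_cost /next_potential stop_probE.
  rewrite survival_psi_star [C t.+1 x]remaining_budgetS.
  apply: (one_step_eq mp0 mp1 p0_ge0 p1_ge0 mr r_itv r0 rE) => //.
  - exact: mstar_gt0.
  - by move=> k k1; rewrite !gainK//; have [_] := mstarM _ (zL_ge0 t x); exact.
  - exact: remaining_budget_ge0.
apply: le_ereal_inf_tmp => _ [psi' psi'B <-].
have psi'P : is_policy psi' by case: psi'B.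
rewrite (weighted_riskE dens0 dens1 abs_cont iid0 iid1 z_ge0 psi'P).
pose C := policy_budget psi' c.
have C0 x : C 0%N x = c.
  by rewrite /C /policy_budget big_geq// subr0 survival0 divr1.
rewrite -(integral_potential0 p0 p1 r Q0 z psi' C0).
apply: (total_cost_ge mp0 mp1 p0_ge0 p1_ge0 mr r_itv iid0 z_ge0 psi'P _ _ _ (c := c)).
- by move=> t; exact: measurable_policy_budget.
- by move=> t x; exact: policy_budget_ge0.
- by move=> t x y; exact: policy_budget_set_coord.
- move=> t x; rewrite /potential /stopping_cost /next_potential stop_probE.
  apply: (one_step_le mp0 mp1 p0_ge0 p1_ge0 mr r_itv r0 rE) => //.
  + by rewrite survival_ge0//= survivalS_le.
  + exact: policy_budget_ge0.
  + exact: policy_budget_ge0.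
  + exact: policy_budgetS.
- exact: (uniform_budgetP psi'P c).1.
Qed.
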